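(* Let $\lambda,\mu>0$, $\mathcal{K}>0$ and $\rho_c>0$ be given. A unique static, self-gravitating elastic ball $(\rho,p_{\mathrm{rad}},p_{\mathrm{tan}})$ in the Seth model with Lamé coefficients $\lambda,\mu$, with reference density $\mathcal{K}$ and with central density $\rho(0)=\rho_c$ exists if and only if $\rho_c>\mathcal{K}$. Moreover, if $r_1>0$ is the radius of the ball, then $\rho(r_1)>0$ and the following estimates hold: \[ \sqrt{\frac{2\lambda}{3\lambda+2\mu}}\left(\frac{3M}{4\pi\mathcal{K}}\right)^{1/3}<r_1<\left(\frac{3M}{4\pi\mathcal{K}}\right)^{1/3},\qquad M<\frac{4\pi}{3}\rho_c r_1^3, \] where $M=m(r_1)>0$ is the total mass of the ball.
   Context: A static, self-gravitating ball (spherically symmetric, of radius $r_1>0$) is a triple $(\rho,p_{\mathrm{rad}},p_{\mathrm{tan}})$ of real functions of $r\ge 0$, $\rho\ge0$, such that: - $\Omega:=\mathrm{Int}\{r>0:\rho(r)>0\}=(0,r_1)$; - $(\rho,p_{\mathrm{rad}},p_{\mathrm{tan}})\in C^1(\Omega)\cap C^0(\overline{\Omega})$ (continuity on $\overline\Omega=[0,r_1]$ of the restrictions to $\overline\Omega$) and in $\Omega$ \[ p_{\mathrm{rad}}'(r)+\frac{2}{r}\big(p_{\mathrm{rad}}(r)-p_{\mathrm{tan}}(r)\big)+\rho(r)\frac{m(r)}{r^2}=0,\qquad m(r)=4\pi\int_0^r\rho(s)s^2\,ds; \] - $p_{\mathrm{rad}},p_{\mathrm{tan}}>0$ in $\Omega$;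 - $p_{\mathrm{rad}}(r_1)=0$, $p_{\mathrm{rad}}(0)>0$ and $p_{\mathrm{rad}}(0)=p_{\mathrm{tan}}(0)$; - $\rho=p_{\mathrm{rad}}=p_{\mathrm{tan}}=0$ on $[0,\infty)\setminus\overline\Omega$. The ball is made of Seth elastic matter with Lamé coefficients $\lambda,\mu>0$ and has reference density $\mathcal{K}>0$ if for $r\in(0,r_1)$ \[ p_{\mathrm{rad}}(r)=\widehat p_{\mathrm{rad}}(\delta(r),\eta(r)),\quad p_{\mathrm{tan}}(r)=\widehat p_{\mathrm{tan}}(\delta(r),\eta(r)),\quad \delta(r)=\frac{\rho(r)}{\mathcal{K}},\quad \eta(r)=\frac{m(r)}{\frac{4\pi}{3}\mathcal{K}r^3}, \] where \[ \widehat p_{\mathrm{rad}}(\delta,\eta)=\lambda\eta^{2/3}+\frac{\lambda+2\mu}{2}\eta^{-4/3}\delta^2-p_0,\quad \widehat p_{\mathrm{tan}}(\delta,\eta)=(\lambda+\mu)\eta^{2/3}+\frac{\lambda}{2}\eta^{-4/3}\delta^2-p_0,\quad p_0=\frac{3\lambda+2\mu}{2}. \] *)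

(* Defs.v *)
From Stdlib Require Import Reals.
From Coquelicot Require Import Coquelicot.
Open Scope R_scope.

(* Profiles are functions R -> R of which only the values at r >= 0 matter. *)

Definition mass (rho : R -> R) (r : R) : R :=
  4 * PI * RInt (fun s => rho s * s ^ 2) 0 r.

Definition C1_on_open_interval (a b : R) (f : R -> R) : Prop :=
  forall r, a < r < b -> ex_derive f r /\ continuous (Derive f) r.

(* [continuous_on D f] is continuity of the restriction of f to D, so a jump
   across the surface r = r1 (the outside is vacuum) is allowed. *)
Definition regular_profile (r1 : R) (f : R -> R) : Prop :=
  C1_on_open_interval 0 r1 f /\ continuous_on (fun r => 0 <= r <= r1) f.

Record static_ball (r1 : R) (rho prad ptan : R -> R) : Prop := {
  ball_radius_pos : 0 < r1;
  ball_density_nonneg : forall r, 0 <= r -> 0 <= rho r;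
  ball_domain :
    forall r, interior (fun s => 0 < s /\ 0 < rho s) r <-> 0 < r < r1;
  ball_density_regular : regular_profile r1 rho;
  ball_prad_regular : regular_profile r1 prad;
  ball_ptan_regular : regular_profile r1 ptan;
  ball_equilibrium : forall r, 0 < r < r1 ->
    Derive prad r + 2 / r * (prad r - ptan r) + rho r * (mass rho r / r ^ 2)
    = 0;
  ball_pressures_pos : forall r, 0 < r < r1 -> 0 < prad r /\ 0 < ptan r;
  ball_surface : prad r1 = 0;
  ball_center_pos : 0 < prad 0;
  ball_center_isotropic : prad 0 = ptan 0;
  ball_vacuum : forall r, r1 < r -> rho r = 0 /\ prad r = 0 /\ ptan r = 0
}.

Definition seth_p0 (lambda mu : R) : R := (3 * lambda + 2 * mu) / 2.

Definition seth_prad (lambda mu delta eta : R) : R :=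
  lambda * Rpower eta (2 / 3)
  + (lambda + 2 * mu) / 2 * Rpower eta (- (4 / 3)) * delta ^ 2
  - seth_p0 lambda mu.

Definition seth_ptan (lambda mu delta eta : R) : R :=
  (lambda + mu) * Rpower eta (2 / 3)
  + lambda / 2 * Rpower eta (- (4 / 3)) * delta ^ 2
  - seth_p0 lambda mu.

Definition rel_density (K : R) (rho : R -> R) (r : R) : R := rho r / K.

Definition rel_mean_density (K : R) (rho : R -> R) (r : R) : R :=
  mass rho r / (4 * PI / 3 * K * r ^ 3).

Definition seth_matter (lambda mu K r1 : R) (rho prad ptan : R -> R) : Prop :=
  forall r, 0 < r < r1 ->
    prad r
      = seth_prad lambda mu (rel_density K rho r) (rel_mean_density K rho r)
    /\ ptan r
      = seth_ptan lambda mu (rel_density K rho r) (rel_mean_density K rho r).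

Definition seth_ball (lambda mu K rhoc r1 : R) (rho prad ptan : R -> R) : Prop :=
  static_ball r1 rho prad ptan
  /\ seth_matter lambda mu K r1 rho prad ptan
  /\ rho 0 = rhoc.

(* Main.v *)
Require Import Defs.
From Stdlib Require Import Reals Lra Psatz Classical_Prop.
From Coquelicot Require Import Coquelicot.
Open Scope R_scope.

(* Let R(r) be the radius that the matter inside radius r would occupy at the
   reference density, and put u = R/r, v = R'.  Then eta = u^3, delta = u^2 v, and
   p_rad, p_tan are quadratic in (u, v), so that the equilibrium equation becomes
   u' = (v - u)/r together with an explicit equation for v', with u = v = a at the
   centre, a^3 = rho_c/K; positive central pressure means a > 1.  Differential
   inequalities give 1 < u < a, v < u, a positive lower bound on v and an upper bound
   on r as long as p_rad > 0, whence the estimates.  In the variables u and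
   y = (v - u)/r the system is u' = y, y' = -4 y/r + F with F locally Lipschitz: the
   singular term has the good sign, which yields uniqueness by an energy estimate and
   existence by a contraction; the bounds then force p_rad to vanish at a finite radius
   where v > 0. *)

(** The exponents [2/3] and [-4/3] turn into squares: [eta ^ (2/3) = u ^ 2] and
    [eta ^ (-4/3) * delta ^ 2 = v ^ 2], while the definition of the mass becomes [(r u)' = v].
    Solved for [v'], the equilibrium equation is singular twice: at the centre and where [v = 0]. At
    the centre, inserting [v = u + r y] gives [F = 2 k y ^ 2 / (u + r y) - c u ^ 5], which has no
    negative power of [r] left. Near [v = 0] anisotropy helps: the term [2 k u ^ 2 / (r v)] pushes
    [v] upwards and wins against gravity as long as [r] stays bounded, so the radius has to be
    bounded before [v] can be bounded below. The barriers give strict inequalities inside the ball,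
    but a limit keeps only weak ones at the surface; the strict estimates there need quantitative
    versions. *)

(** * Barriers and passage to the limit in inequalities *)

Lemma locally_interval (a b x : R) (P : R -> Prop) :
  a < x < b -> (forall z, a < z < b -> P z) -> locally x P.
Proof.
intros hx h.
assert (hd : 0 < Rmin (x - a) (b - x)) by (apply Rmin_glb_lt; lra).
exists (mkposreal _ hd). intros z hz. apply h.
change (Rabs (z - x) < Rmin (x - a) (b - x)) in hz.
pose proof (Rmin_l (x - a) (b - x)). pose proof (Rmin_r (x - a) (b - x)).
apply Rabs_def2 in hz. lra.
Qed.

(* If [f r >= 0], then [f] attains its maximum over [[0, r]] at a point [x > 0] with
   [f x >= 0], where a negative derivative is impossible. *)
Lemma barrier (f : R -> R) (b : R) :
  (forall r, continuous f r) -> f 0 <= 0 ->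
  (forall r, 0 < r < b -> 0 <= f r -> exists l, is_derive f r l /\ l < 0) ->
  forall r, 0 < r < b -> f r < 0.
Proof.
intros fc f0 fd r hr.
destruct (Rlt_le_dec (f r) 0) as [h | h]; [exact h | exfalso].
assert (hmax : exists x, 0 < x <= r /\ 0 <= f x /\
    forall z, 0 <= z <= r -> f z <= f x).
{ destruct (continuity_ab_maj f 0 r) as [x [xM hx]]; [lra | | ].
  - intros z _. apply continuity_pt_filterlim, fc.
  - pose proof (xM r ltac:(lra)) as hrx.
    destruct (Req_dec x 0) as [-> | nx].
    (* A maximum at [0] has value [f 0 <= 0 <= f r], so [r] is a maximum point as well. *)
    + exists r. repeat split; try lra. intros z hz. specialize (xM z hz). lra.
    + exists x. repeat split; try lra. exact xM. }
destruct hmax as [x [hx [fx xM]]].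
destruct (fd x ltac:(lra) fx) as [l [dl hl]].
apply is_derive_Reals in dl.
destruct (dl (- l / 2) ltac:(lra)) as [d hd].
set (h1 := - Rmin (d / 2) x).
assert (hm : 0 < Rmin (d / 2) x <= d / 2 /\ Rmin (d / 2) x <= x).
{ pose proof (cond_pos d). split; [split|].
  - apply Rmin_glb_lt; lra.
  - apply Rmin_l.
  - apply Rmin_r. }
assert (hq := hd h1 ltac:(unfold h1; lra)
  ltac:(unfold h1; rewrite Rabs_Ropp, Rabs_pos_eq; pose proof (cond_pos d); lra)).
specialize (xM (x + h1) ltac:(unfold h1; lra)).
apply Rabs_def2 in hq.
assert (0 <= (f (x + h1) - f x) / h1).
{ replace ((f (x + h1) - f x) / h1) with ((f x - f (x + h1)) / (- h1))
    by (field; unfold h1; lra).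
  apply Rle_mult_inv_pos; unfold h1 in *; lra. }
lra.
Qed.

Lemma decreasing_of_derive (f : R -> R) (p q : R) :
  p <= q ->
  (forall r, p <= r <= q -> exists l, is_derive f r l /\ l <= 0) ->
  f q <= f p.
Proof.
intros pq fd.
destruct (MVT_gen f p q (Derive f)) as [z [hz e]].
- intros x hx. rewrite Rmin_left, Rmax_right in hx by lra.
  destruct (fd x ltac:(lra)) as [l [dl _]].
  apply Derive_correct. now exists l.
- intros x hx. rewrite Rmin_left, Rmax_right in hx by lra.
  destruct (fd x ltac:(lra)) as [l [dl _]].
  apply continuity_pt_filterlim, (ex_derive_continuous f). now exists l.
- rewrite Rmin_left, Rmax_right in hz by lra.
  destruct (fd z hz) as [l [dl hl]].
  rewrite (is_derive_unique _ _ _ dl) in e. nra.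
Qed.

(** Carries bounds known on an open interval to the surface; [le_of_le_right] does the same at the
    centre. *)
Lemma le_of_le_left (f g : R -> R) (x b : R) :
  x < b -> continuous f b -> continuous g b ->
  (forall r, x < r < b -> f r <= g r) -> f b <= g b.
Proof.
intros hb fc gc h.
apply (filterlim_le (F := at_left b) f g (f b) (g b)).
- assert (hd : 0 < b - x) by lra.
  exists (mkposreal _ hd). intros r hr lr. apply h.
  apply Rabs_def2 in hr. unfold minus, plus, opp in hr; simpl in hr. lra.
- eapply filterlim_filter_le_1; [| exact fc]. apply filter_le_within.
- eapply filterlim_filter_le_1; [| exact gc]. apply filter_le_within.
Qed.

Lemma le_of_le_right (f g : R -> R) (x b : R) :
  x < b -> continuous f x -> continuous g x ->
  (forall r, x < r < b -> f r <= g r) -> f x <= g x.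
Proof.
intros hb fc gc h.
apply (filterlim_le (F := at_right x) f g (f x) (g x)).
- assert (hd : 0 < b - x) by lra.
  exists (mkposreal _ hd). intros r hr lr. apply h.
  apply Rabs_def2 in hr. unfold minus, plus, opp in hr; simpl in hr. lra.
- eapply filterlim_filter_le_1; [| exact fc]. apply filter_le_within.
- eapply filterlim_filter_le_1; [| exact gc]. apply filter_le_within.
Qed.

(** * Clipping and continuity *)

(** The projection onto [[lo, hi]]. It serves two ends: making the equation globally Lipschitz, and
    extending functions continuous on an interval to all of [R]. *)
Definition clip (lo hi x : R) : R := Rmax lo (Rmin hi x).

Lemma clip_range (lo hi x : R) : lo <= hi -> lo <= clip lo hi x <= hi.
Proof.
intros h. unfold clip. split; [apply Rmax_l|].
apply Rmax_lub; [exact h|apply Rmin_l].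
Qed.

Lemma clip_id (lo hi x : R) : lo <= x <= hi -> clip lo hi x = x.
Proof. intros h. unfold clip. rewrite Rmin_right, Rmax_right; lra. Qed.

Lemma clip_lipschitz (lo hi x y : R) :
  Rabs (clip lo hi x - clip lo hi y) <= Rabs (x - y).
Proof.
unfold clip, Rmax, Rmin, Rabs.
repeat destruct Rle_dec; repeat destruct Rcase_abs; lra.
Qed.

Lemma continuous_lipschitz (f : R -> R) (x : R) :
  (forall y z, Rabs (f y - f z) <= Rabs (y - z)) -> continuous f x.
Proof.
intros h P [eps he]. exists eps. intros y hy. apply he.
unfold ball in *; simpl in *; unfold AbsRing_ball, abs, minus, plus, opp in *; simpl in *.
eapply Rle_lt_trans; [apply h|exact hy].
Qed.

Lemma continuous_clip (lo hi : R) (f : R -> R) (x : R) :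
  continuous f x -> continuous (fun z => clip lo hi (f z)) x.
Proof.
intros fc. apply (continuous_comp f (clip lo hi)); [exact fc|].
apply continuous_lipschitz. apply clip_lipschitz.
Qed.

Lemma continuous_Rmax (m : R) (f : R -> R) (x : R) :
  continuous f x -> continuous (fun z => Rmax m (f z)) x.
Proof.
intros fc. apply (continuous_comp f (Rmax m)); [exact fc|].
apply continuous_lipschitz. intros y z.
unfold Rmax, Rabs. repeat destruct Rle_dec; repeat destruct Rcase_abs; lra.
Qed.

Lemma continuous_pow (f : R -> R) (n : nat) (x : R) :
  continuous f x -> continuous (fun z => f z ^ n) x.
Proof.
intros fc. induction n as [|n IH]; simpl.
- apply continuous_const.
- exact (continuous_mult (K := R_AbsRing) f _ x fc IH).
Qed.

Lemma continuous_div (f g : R -> R) (x : R) :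
  continuous f x -> continuous g x -> g x <> 0 -> continuous (fun z => f z / g z) x.
Proof.
intros fc gc gx. apply (continuous_mult (K := R_AbsRing) f (fun z => / g z)).
- exact fc.
- now apply continuous_comp with (2 := continuous_Rinv (g x) gx).
Qed.

(** Continuity by structure of the term. A nonzero denominator is left as a goal whenever [lra]
    cannot prove it. *)
Ltac cont :=
  lazymatch goal with
  | H : forall r, continuous ?f r |- continuous ?f _ => apply H
  | |- continuous (fun x => x) _ => apply continuous_id
  | |- continuous (fun x => @?f x + @?g x) ?r =>
      apply (continuous_plus (V := R_NormedModule) f g r); cont
  | |- continuous (fun x => @?f x - @?g x) ?r =>
      apply (continuous_minus (V := R_NormedModule) f g r); cont
  | |- continuous (fun x => @?f x * @?g x) ?r =>
      apply (continuous_mult (K := R_AbsRing) f g r); cont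
  | |- continuous (fun x => @?f x ^ ?n) ?r =>
      apply (continuous_pow f n r); cont
  | |- continuous (fun x => @?f x / @?g x) ?r =>
      apply (continuous_div f g r); [cont | cont | cbv beta; try lra]
  | |- continuous (fun x => clip ?lo ?hi (@?f x)) ?r =>
      apply (continuous_clip lo hi f r); cont
  | |- continuous (fun x => Rmax ?m (@?f x)) ?r =>
      apply (continuous_Rmax m f r); cont
  | |- continuous (fun x => - @?f x) ?r =>
      apply (continuous_opp (V := R_NormedModule) f r); cont
  | H : forall r, continuous ?f r |- continuous (fun x => ?f x) _ => apply H
  | |- continuous (fun _ => ?C) _ => apply continuous_const
  | _ => try eassumption
  end.

(** [auto_derive] leaves [Derive] of an abstract function in its goals; this replaces it by the
    value known from [H]. *)
Ltac rw_derive H :=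
  match type of H with is_derive ?f ?x ?l =>
    replace (Derive (fun z => f z) x) with l
      by (symmetry; apply is_derive_unique, H)
  end.

(** * Bounds for integrals and uniform limits *)

Lemma Rabs_le_sub_mul (x1 x2 y1 y2 B C d e : R) :
  Rabs x1 <= B -> Rabs y2 <= C -> Rabs (x1 - x2) <= d -> Rabs (y1 - y2) <= e ->
  Rabs (x1 * y1 - x2 * y2) <= B * e + C * d.
Proof.
intros h1 h2 h3 h4.
replace (x1 * y1 - x2 * y2) with (x1 * (y1 - y2) + y2 * (x1 - x2)) by ring.
eapply Rle_trans; [apply Rabs_triang|]. rewrite !Rabs_mult.
apply Rplus_le_compat; apply Rmult_le_compat; auto using Rabs_pos.
Qed.

Lemma RInt_derive (f : R -> R) (r : R) :
  (forall x, continuous f x) -> is_derive (fun x => RInt f 0 x) r (f r).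
Proof.
intros fc. apply (is_derive_RInt f (fun x => RInt f 0 x) 0 r); [|apply fc].
apply filter_forall. intros x. apply (RInt_correct f), (ex_RInt_continuous f).
intros z _. apply fc.
Qed.

Lemma continuous_RInt_upper (f : R -> R) (r : R) :
  (forall x, continuous f x) -> continuous (fun x => RInt f 0 x) r.
Proof.
intros fc. apply (ex_derive_continuous (fun x => RInt f 0 x)).
exists (f r). now apply RInt_derive.
Qed.

(** Integration gains a factor [1 / q] on the exponential weight; this is what beats a Lipschitz
    constant on an interval of any length. For [e = 1] and [e = -1],
    [e * RInt f 0 r - D / q * exp (q * r)] is nonincreasing and starts at [- D / q]. *)
Lemma RInt_exp_bound (f : R -> R) (D q r : R) : 0 <= D -> 0 < q -> 0 <= r ->
  (forall x, continuous f x) ->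
  (forall s, 0 <= s <= r -> Rabs (f s) <= D * exp (q * s)) ->
  Rabs (RInt f 0 r) <= D / q * exp (q * r).
Proof.
intros hD hq hr fc hf.
assert (Dq : 0 <= D / q) by now apply Rle_mult_inv_pos.
assert (aux : forall e, Rabs e <= 1 -> e * RInt f 0 r <= D / q * exp (q * r)).
{ intros e he.
  assert (h : e * RInt f 0 r - D / q * exp (q * r) <= e * RInt f 0 0 - D / q * exp (q * 0)).
  { apply (decreasing_of_derive (fun r => e * RInt f 0 r - D / q * exp (q * r))); [exact hr|].
    intros s hs. pose proof (RInt_derive f s fc) as dI.
    exists (e * f s - D * exp (q * s)). split.
    - apply (is_derive_minus (V := R_NormedModule) (fun r => e * RInt f 0 r)
        (fun r => D / q * exp (q * r))).
      + exact (is_derive_scal _ _ e _ dI).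
      + auto_derive; [exact I|]. field. lra.
    - specialize (hf s hs).
      assert (e * f s <= Rabs e * Rabs (f s)) by (rewrite <- Rabs_mult; apply Rle_abs).
      pose proof (Rabs_pos e). pose proof (Rabs_pos (f s)). nra. }
  rewrite RInt_point in h. change (@zero R_CompleteNormedModule) with 0 in h.
  rewrite !Rmult_0_r, exp_0 in h.
  lra. }
apply Rabs_le. split.
- specialize (aux (- (1)) ltac:(rewrite Rabs_Ropp, Rabs_R1; lra)). lra.
- specialize (aux 1 ltac:(rewrite Rabs_R1; lra)). lra.
Qed.

Lemma continuous_of_dominated (f : R -> R) (x M : R) : 0 <= M ->
  (forall z, Rabs (f z - f x) <= M * Rabs (z - x)) -> continuous f x.
Proof.
intros hM h. apply filterlim_locally. intros eps.
assert (hd : 0 < eps / (M + 1)) by (apply Rdiv_lt_0_compat; [apply cond_pos|lra]).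
exists (mkposreal _ hd). intros z hz.
change (Rabs (z - x) < eps / (M + 1)) in hz. change (Rabs (f z - f x) < eps).
assert (e : eps / (M + 1) * (M + 1) = eps) by (field; lra).
specialize (h z). pose proof (Rabs_pos (z - x)). nra.
Qed.

Lemma continuous_of_uniform_limit (f : nat -> R -> R) (g : R -> R) (W : R) :
  (forall n x, continuous (f n) x) ->
  (forall n x, Rabs (f n x - g x) <= W * (/ 2) ^ n) ->
  forall x, continuous g x.
Proof.
intros fc h x. apply filterlim_locally. intros eps.
destruct (pow_lt_1_zero (/ 2) ltac:(rewrite Rabs_pos_eq; lra)
  (eps / (3 * (Rabs W + 1)))) as [N hN].
{ pose proof (cond_pos eps). pose proof (Rabs_pos W). apply Rdiv_lt_0_compat; lra. }
specialize (hN N (le_n N)). rewrite Rabs_pos_eq in hN by (apply pow_le; lra).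
assert (hW : W * (/ 2) ^ N < eps / 3).
{ pose proof (Rabs_pos W). assert (0 < (/ 2) ^ N) by (apply pow_lt; lra).
  pose proof (Rle_abs W).
  replace (eps / 3) with ((Rabs W + 1) * (eps / (3 * (Rabs W + 1)))) by (field; lra).
  apply Rle_lt_trans with (Rabs W * (/ 2) ^ N); nra. }
assert (e3 : 0 < eps / 3) by (pose proof (cond_pos eps); lra).
pose proof (proj1 (filterlim_locally (F := locally x) (f N) (f N x)) (fc N x) (mkposreal _ e3)) as hc.
revert hc. apply filter_imp. intros z hz.
change (Rabs (f N z - f N x) < eps / 3) in hz. change (Rabs (g z - g x) < eps).
pose proof (h N z) as h1. pose proof (h N x) as h2.
apply Rabs_le_between in h1. apply Rabs_le_between in h2. apply Rabs_def2 in hz.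
apply Rabs_def1; lra.
Qed.

(** * A singular initial value problem *)

(* For [u' = y] and [(r ^ 4 y)' = r ^ 4 F(r, u, y)]; the weight [exp (rate * r)] makes
   the integral operator a contraction on the whole of [[0, T]]. *)
Section Picard.

Variables (T a L M : R) (F : R -> R -> R -> R).
Hypotheses (hT : 0 < T) (hL : 0 <= L) (hM : 0 <= M).
Hypothesis F_lip : forall r u y u' y',
  Rabs (F r u y - F r u' y') <= L * (Rabs (u - u') + Rabs (y - y')).
Hypothesis F_bounded : forall r u y, Rabs (F r u y) <= M.
Hypothesis F_cont : forall u y,
  (forall r, continuous u r) -> (forall r, continuous y r) ->
  forall r, continuous (fun s => F s (u s) (y s)) r.

Definition primitive (y : R -> R) (r : R) : R := a + RInt y 0 r.

Definition integrand (y : R -> R) (s : R) : R := s ^ 4 * F s (primitive y s) (y s).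

(** The equation [(r ^ 4 y)' = r ^ 4 F] integrated from the centre. Clipping makes the function
    constant outside [[0, T]], so that continuity can be asked on all of [R]; at [0] the numerator
    vanishes and the quotient is [0], the right initial value. *)
Definition picard (y : R -> R) (r : R) : R :=
  RInt (integrand y) 0 (clip 0 T r) / clip 0 T r ^ 4.

Lemma primitive_derive (y : R -> R) (r : R) :
  (forall x, continuous y x) -> is_derive (primitive y) r (y r).
Proof.
intros yc. unfold primitive.
pose proof (RInt_derive y r yc) as d.
rewrite <- (Rplus_0_l (y r)).
apply (is_derive_plus (V := R_NormedModule) (fun _ => a) (fun x => RInt y 0 x)); [|exact d].
apply (is_derive_const (V := R_NormedModule)).
Qed.

Lemma primitive_cont (y : R -> R) (r : R) :
  (forall x, continuous y x) -> continuous (primitive y) r.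
Proof.
intros yc. apply (ex_derive_continuous (primitive y)). exists (y r). now apply primitive_derive.
Qed.

Lemma integrand_cont (y : R -> R) (r : R) :
  (forall x, continuous y x) -> continuous (integrand y) r.
Proof.
intros yc. unfold integrand.
assert (h : forall r, continuous (fun s => F s (primitive y s) (y s)) r).
{ apply F_cont; [|exact yc]. intros x. now apply primitive_cont. }
apply (continuous_mult (K := R_AbsRing) (fun s => s ^ 4)); [cont|apply h].
Qed.

(** Bounding [s ^ 4] by its value at the upper limit cancels the denominator and leaves the length
    of the interval, a factor that also gives continuity at the centre. *)
Lemma picard_bound (y : R -> R) (r : R) :
  (forall x, continuous y x) -> Rabs (picard y r) <= M * clip 0 T r.
Proof.
intros yc. unfold picard.
pose proof (clip_range 0 T r ltac:(lra)) as hr. set (x := clip 0 T r) in *.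
destruct (Req_dec x 0) as [-> | nx].
- rewrite RInt_point. unfold zero; simpl. unfold Rdiv.
  rewrite Rmult_0_l, Rmult_0_r, Rabs_R0. lra.
- assert (x4 : 0 < x ^ 4) by (apply pow_lt; lra).
  unfold Rdiv. rewrite Rabs_mult, (Rabs_pos_eq (/ _)) by (left; now apply Rinv_0_lt_compat).
  apply (Rmult_le_reg_r (x ^ 4)); [exact x4|].
  rewrite Rmult_assoc, Rinv_l, Rmult_1_r by lra.
  replace (M * x * x ^ 4) with ((x - 0) * (x ^ 4 * M)) by ring.
  apply abs_RInt_le_const; [lra| |].
  + apply (ex_RInt_continuous (V := R_CompleteNormedModule)). intros z _. now apply integrand_cont.
  + intros t ht. unfold integrand. rewrite Rabs_mult.
    apply Rmult_le_compat; try apply Rabs_pos; [|apply F_bounded].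
    rewrite Rabs_pos_eq by (apply pow_le; lra). apply pow_incr. lra.
Qed.

Lemma picard_cont (y : R -> R) (r : R) :
  (forall x, continuous y x) -> continuous (picard y) r.
Proof.
intros yc.
destruct (Req_dec (clip 0 T r) 0) as [h0 | h0].
- apply continuous_of_dominated with M; [exact hM|]. intros z.
  assert (picard y r = 0) as ->.
  { unfold picard. rewrite h0, RInt_point. unfold zero; simpl. unfold Rdiv. ring. }
  rewrite Rminus_0_r. eapply Rle_trans; [now apply picard_bound|].
  apply Rmult_le_compat_l; [exact hM|].
  eapply Rle_trans; [|apply (clip_lipschitz 0 T)]. rewrite h0, Rminus_0_r. apply Rle_abs.
- unfold picard. apply (continuous_div (fun r => RInt (integrand y) 0 (clip 0 T r))
    (fun r => clip 0 T r ^ 4)).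
  + apply (continuous_comp (clip 0 T) (fun x => RInt (integrand y) 0 x)).
    * apply (continuous_clip 0 T (fun z => z)). apply continuous_id.
    * apply continuous_RInt_upper. intros x. now apply integrand_cont.
  + cont.
  + now apply pow_nonzero.
Qed.

(** Chosen so that [2 * L / rate <= 1 / 2], the contraction factor; [rate >= 1] makes the difference
    of the primitives no larger than the bound on the difference of the [y]. *)
Definition rate : R := 4 * L + 1.

Lemma picard_contract (y z : R -> R) (D : R) : 0 <= D ->
  (forall x, continuous y x) -> (forall x, continuous z x) ->
  (forall s, 0 <= s <= T -> Rabs (y s - z s) <= D * exp (rate * s)) ->
  forall r, Rabs (picard y r - picard z r) <= D / 2 * exp (rate * clip 0 T r).
Proof.
intros hD yc zc h r. unfold picard.
pose proof (clip_range 0 T r ltac:(lra)) as hr. set (x := clip 0 T r) in *.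
pose proof (exp_pos (rate * x)).
assert (rp : 1 <= rate) by (unfold rate; lra).
destruct (Req_dec x 0) as [x0 | nx].
{ rewrite x0, !RInt_point. unfold zero; simpl. unfold Rdiv at 1 2.
  rewrite !Rmult_0_l, Rminus_diag, Rabs_R0. pose proof (exp_pos (rate * 0)). nra. }
assert (x4 : 0 < x ^ 4) by (apply pow_lt; lra).
assert (exI : forall w b, (forall x : R, continuous (w : R -> R) x) -> ex_RInt (V := R_NormedModule) w 0 b).
{ intros w b wc. apply (ex_RInt_continuous (V := R_CompleteNormedModule) w). intros s _. apply wc. }
unfold Rdiv at 1 2. rewrite <- Rmult_minus_distr_r, Rabs_mult.
rewrite (Rabs_pos_eq (/ _)) by (left; now apply Rinv_0_lt_compat).
apply (Rmult_le_reg_r (x ^ 4)); [exact x4|].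
rewrite Rmult_assoc, Rinv_l, Rmult_1_r by lra.
pose proof (fun s => integrand_cont y s yc) as gyc.
pose proof (fun s => integrand_cont z s zc) as gzc.
change (Rabs (minus (RInt (integrand y) 0 x) (RInt (integrand z) 0 x))
  <= D / 2 * exp (rate * x) * x ^ 4).
rewrite <- RInt_minus by (apply exI; assumption).
change (Rabs (RInt (fun s => integrand y s + - integrand z s) 0 x)
  <= D / 2 * exp (rate * x) * x ^ 4).
(* Under the integral [s ^ 4 <= x ^ 4], and [F_lip] contributes [L * D] once for [u] and once for
   [y]; integrating the weight divides by [rate]. *)
apply Rle_trans with (x ^ 4 * (2 * L * D) / rate * exp (rate * x)).
- apply (RInt_exp_bound (fun s => integrand y s + - integrand z s)); try lra.
  + apply Rmult_le_pos; nra.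
  + intros s. apply (continuous_minus (V := R_NormedModule) (integrand y)); auto.
  + intros s hs. unfold integrand.
    replace (s ^ 4 * F s (primitive y s) (y s) + - (s ^ 4 * F s (primitive z s) (z s)))
      with (s ^ 4 * (F s (primitive y s) (y s) - F s (primitive z s) (z s))) by ring.
    rewrite Rabs_mult, Rmult_assoc.
    assert (0 <= s ^ 4 <= x ^ 4) by (split; [apply pow_le|apply pow_incr]; lra).
    rewrite (Rabs_pos_eq (s ^ 4)) by lra.
    apply Rmult_le_compat; try lra; [apply Rabs_pos|].
    eapply Rle_trans; [apply F_lip|].
    pose proof (exp_pos (rate * s)).
    replace (2 * L * D * exp (rate * s))
      with (L * (D * exp (rate * s) + D * exp (rate * s))) by ring.
    apply Rmult_le_compat_l; [exact hL|]. apply Rplus_le_compat; [|apply h; lra].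
    unfold primitive.
    replace (a + RInt y 0 s - (a + RInt z 0 s)) with (minus (RInt y 0 s) (RInt z 0 s))
      by (unfold minus, plus, opp; simpl; ring).
    rewrite <- RInt_minus by (apply exI; assumption).
    apply Rle_trans with (D / rate * exp (rate * s)).
    * apply (RInt_exp_bound (fun t => minus (y t) (z t))); try lra.
      -- intros t. apply (continuous_minus (V := R_NormedModule) y z); auto.
      -- intros t ht. apply h. lra.
    * apply Rmult_le_compat_r; [lra|]. unfold Rdiv. rewrite <- (Rmult_1_r D) at 2.
      apply Rmult_le_compat_l; [exact hD|]. rewrite <- Rinv_1.
      apply Rinv_le_contravar; lra.
- replace (D / 2 * exp (rate * x) * x ^ 4) with (x ^ 4 * (D / 2) * exp (rate * x)) by ring.
  apply Rmult_le_compat_r; [lra|]. unfold Rdiv. rewrite Rmult_assoc.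
  apply Rmult_le_compat_l; [lra|].
  apply (Rmult_le_reg_r rate); [lra|]. rewrite Rmult_assoc, Rinv_l by lra.
  unfold rate. nra.
Qed.

Fixpoint iterate (n : nat) : R -> R :=
  match n with O => fun _ => 0 | S n => picard (iterate n) end.

Lemma iterate_cont (n : nat) (r : R) : continuous (iterate n) r.
Proof.
revert r. induction n as [|n IH]; intros r; simpl; [apply continuous_const|].
now apply picard_cont.
Qed.

(** A bound [M * T] for the first iterate times the largest weight: the steps halve in the weighted
    norm, and the weight is estimated only at the end. *)
Definition width : R := M * T * exp (rate * T).

Lemma iterate_step (n : nat) (r : R) :
  Rabs (iterate (S n) r - iterate n r) <= width * (/ 2) ^ n.
Proof.
assert (rp : 1 <= rate) by (unfold rate; lra).
assert (MT : 0 <= M * T) by nra.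
assert (aux : forall r, Rabs (iterate (S n) r - iterate n r)
  <= M * T * (/ 2) ^ n * exp (rate * clip 0 T r)).
{ clear r. induction n as [|n IH]; intros r.
  - simpl. rewrite Rminus_0_r, Rmult_1_r.
    pose proof (clip_range 0 T r ltac:(lra)).
    eapply Rle_trans; [apply picard_bound; intros; apply continuous_const|].
    assert (1 <= exp (rate * clip 0 T r)).
    { rewrite <- exp_0. destruct (Req_dec (rate * clip 0 T r) 0) as [-> | ]; [lra|].
      left. apply exp_increasing. assert (0 <= rate * clip 0 T r) by nra. lra. }
    assert (M * clip 0 T r <= M * T) by (apply Rmult_le_compat_l; lra). nra.
  - replace (M * T * (/ 2) ^ S n) with (M * T * (/ 2) ^ n / 2) by (simpl; field).
    apply (picard_contract (iterate (S n)) (iterate n)); try apply iterate_cont.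
    + assert (0 < (/ 2) ^ n) by (apply pow_lt; lra). nra.
    + intros s hs. rewrite <- (clip_id 0 T s hs) at 3. apply IH. }
eapply Rle_trans; [apply aux|]. unfold width.
pose proof (clip_range 0 T r ltac:(lra)).
assert (0 < (/ 2) ^ n) by (apply pow_lt; lra).
replace (M * T * exp (rate * T) * (/ 2) ^ n) with (M * T * (/ 2) ^ n * exp (rate * T)) by ring.
apply Rmult_le_compat_l; [nra|].
destruct (Req_dec (clip 0 T r) T) as [-> | ]; [lra|].
left. apply exp_increasing. nra.
Qed.

(** The subtracted term is what lets the induction on [p] close: each step costs at most what the
    geometric tail loses. *)
Lemma iterate_cauchy (n p : nat) (r : R) :
  Rabs (iterate (n + p) r - iterate n r) <= 2 * width * (/ 2) ^ n - 2 * width * (/ 2) ^ (n + p).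
Proof.
induction p as [|p IH].
- rewrite Nat.add_0_r, Rminus_diag, Rabs_R0. lra.
- rewrite Nat.add_succ_r. pose proof (iterate_step (n + p) r) as h.
  replace (iterate (S (n + p)) r - iterate n r) with
    ((iterate (S (n + p)) r - iterate (n + p) r) + (iterate (n + p) r - iterate n r)) by ring.
  eapply Rle_trans; [apply Rabs_triang|]. simpl ((/ 2) ^ S _). lra.
Qed.

Definition limit (r : R) : R := real (Lim_seq (fun n => iterate n r)).

Lemma width_nonneg : 0 <= width.
Proof.
unfold width. pose proof (exp_pos (rate * T)). apply Rmult_le_pos; [apply Rmult_le_pos|]; lra.
Qed.

Lemma iterate_limit (n : nat) (r : R) :
  Rabs (iterate n r - limit r) <= 2 * width * (/ 2) ^ n.
Proof.
pose proof width_nonneg as hw.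
assert (tail : forall n p, Rabs (iterate (n + p) r - iterate n r) <= 2 * width * (/ 2) ^ n).
{ intros m p. pose proof (iterate_cauchy m p r).
  assert (0 < (/ 2) ^ (m + p)) by (apply pow_lt; lra).
  assert (0 <= 2 * width * (/ 2) ^ (m + p)) by nra. lra. }
assert (ex : ex_finite_lim_seq (fun n => iterate n r)).
{ apply ex_lim_seq_cauchy_corr. intros eps.
  destruct (pow_lt_1_zero (/ 2) ltac:(rewrite Rabs_pos_eq; lra)
    (eps / (4 * width + 1))) as [N hN].
  { pose proof (cond_pos eps). apply Rdiv_lt_0_compat; lra. }
  specialize (hN N (le_n N)). rewrite Rabs_pos_eq in hN by (apply pow_le; lra).
  exists N. intros m q hm hq.
  pose proof (tail N (m - N)%nat) as h1. pose proof (tail N (q - N)%nat) as h2.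
  replace (N + (m - N))%nat with m in h1 by lia.
  replace (N + (q - N))%nat with q in h2 by lia.
  assert (4 * width * (/ 2) ^ N < eps).
  { assert (eps / (4 * width + 1) * (4 * width + 1) = eps) by (field; lra).
    assert (0 < (/ 2) ^ N) by (apply pow_lt; lra). nra. }
  apply Rabs_le_between in h1. apply Rabs_le_between in h2. apply Rabs_def1; lra. }
apply Lim_seq_correct' in ex. fold (limit r) in ex.
assert (h := is_lim_seq_incr_n (fun n => iterate n r) n (limit r)).
apply h in ex. clear h.
rewrite Rabs_minus_sym.
assert (cv : is_lim_seq (fun p => Rabs (iterate (p + n) r - iterate n r))
  (Rabs (limit r - iterate n r))).
{ apply (is_lim_seq_abs _ (limit r - iterate n r)).
  apply (is_lim_seq_minus' _ _ (limit r) (iterate n r)); [exact ex|].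
  apply is_lim_seq_const. }
refine (is_lim_seq_le _ _ (Rabs (limit r - iterate n r)) (2 * width * (/ 2) ^ n) _ cv
  (is_lim_seq_const _)).
intros p. rewrite Nat.add_comm. apply tail.
Qed.

Lemma limit_cont (r : R) : continuous limit r.
Proof.
revert r. apply (continuous_of_uniform_limit iterate limit (2 * width)).
- apply iterate_cont.
- apply iterate_limit.
Qed.

Lemma limit_fixpoint (r : R) : picard limit r = limit r.
Proof.
pose proof width_nonneg as hw.
assert (rp : 1 <= rate) by (unfold rate; lra).
set (Z := width * exp (rate * T) + width).
(* [iterate (S n) = picard (iterate n)] is close to both [picard limit] and [limit]. *)
assert (h : forall n, Rabs (picard limit r - limit r) <= Z * (/ 2) ^ n).
{ intros n. assert (p2 : 0 < (/ 2) ^ n) by (apply pow_lt; lra).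
  assert (h1 : Rabs (picard (iterate n) r - picard limit r) <= width * exp (rate * T) * (/ 2) ^ n).
  { eapply Rle_trans.
    - apply picard_contract with (D := 2 * width * (/ 2) ^ n);
        [nra|apply iterate_cont|apply limit_cont|].
      intros s hs. eapply Rle_trans; [apply iterate_limit|].
      rewrite <- (Rmult_1_r (2 * width * (/ 2) ^ n)) at 1.
      apply Rmult_le_compat_l; [nra|]. rewrite <- exp_0.
      destruct (Req_dec (rate * s) 0) as [-> | ]; [lra|].
      left. apply exp_increasing. assert (0 <= rate * s) by nra. lra.
    - pose proof (clip_range 0 T r ltac:(lra)).
      assert (exp (rate * clip 0 T r) <= exp (rate * T)).
      { destruct (Req_dec (clip 0 T r) T) as [-> | ]; [lra|].
        left. apply exp_increasing. nra. }
      replace (2 * width * (/ 2) ^ n / 2) with (width * (/ 2) ^ n) by field.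
      assert (0 <= width * (/ 2) ^ n) by nra. nra. }
  pose proof (iterate_limit (S n) r) as h2. simpl in h2.
  apply Rabs_le_between in h1. apply Rabs_le_between in h2.
  apply Rabs_le. unfold Z. lra. }
assert (z0 : Rabs (picard limit r - limit r) <= 0).
{ refine (is_lim_seq_le _ (fun n => Z * (/ 2) ^ n)
    (Rabs (picard limit r - limit r)) 0 h (is_lim_seq_const _) _).
  rewrite <- (Rmult_0_r Z) at 1.
  apply (is_lim_seq_scal_l _ Z 0). apply is_lim_seq_geom. rewrite Rabs_pos_eq; lra. }
pose proof (Rabs_pos (picard limit r - limit r)).
destruct (Req_dec (picard limit r - limit r) 0) as [e | ne]; [lra|].
apply Rabs_pos_lt in ne. lra.
Qed.

Lemma singular_picard : exists u y : R -> R,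
  (forall r, continuous y r) /\ u 0 = a /\ y 0 = 0 /\
  (forall r, is_derive u r (y r)) /\
  (forall r, 0 < r < T -> is_derive y r (F r (u r) (y r) - 4 * y r / r)).
Proof.
exists (primitive limit), limit. split; [|split; [|split; [|split]]].
- apply limit_cont.
- unfold primitive. rewrite RInt_point. unfold zero; simpl. ring.
- rewrite <- limit_fixpoint. unfold picard. rewrite clip_id by lra.
  rewrite RInt_point. unfold zero; simpl. unfold Rdiv. ring.
- intros r. apply primitive_derive. apply limit_cont.
- intros r hr.
  pose proof (RInt_derive (integrand limit) r (fun x => integrand_cont limit x limit_cont)) as dI.
  assert (e : forall x, 0 < x < T -> limit x = RInt (integrand limit) 0 x / x ^ 4).
  { intros x hx. rewrite <- limit_fixpoint. unfold picard. rewrite clip_id by lra. reflexivity. }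
  apply (is_derive_ext_loc (fun x => RInt (integrand limit) 0 x / x ^ 4)).
  { apply (locally_interval 0 T r _ hr). intros x hx. symmetry. now apply e. }
  rewrite (e r hr) at 2.
  set (I := fun x => RInt (integrand limit) 0 x) in *.
  change (is_derive (fun x => I x / x ^ 4) r
    (F r (primitive limit r) (limit r) - 4 * (I r / r ^ 4) / r)).
  auto_derive.
  + split; [eexists; eassumption|]. split; [|exact Logic.I]. apply Rgt_not_eq, (pow_lt r 4); lra.
  + rw_derive dI. unfold integrand. field. lra.
Qed.

End Picard.

(** Continuous induction: at the supremum [b] of the initial segments where [P] holds, either [P b]
    fails, or openness carries [P] past [b] unless [T] has been reached. *)
Lemma first_exit (P : R -> Prop) (T : R) : 0 < T -> P 0 ->
  (forall r, P r -> locally r P) ->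
  (forall r, 0 <= r <= T -> P r) \/
  exists b, 0 < b <= T /\ ~ P b /\ forall r, 0 <= r < b -> P r.
Proof.
intros hT P0 Pl.
set (A := fun r => 0 <= r <= T /\ forall s, 0 <= s <= r -> P s).
destruct (completeness A) as [b [ub lub]].
- exists T. intros r [hr _]. lra.
- exists 0. split; [lra|]. intros s hs. replace s with 0 by lra. exact P0.
- assert (b0 : 0 <= b) by (apply ub; split; [lra|]; intros s hs; replace s with 0 by lra; exact P0).
  assert (bT : b <= T) by (apply lub; intros r [hr _]; lra).
  assert (below : forall r, 0 <= r < b -> P r).
  { intros r hr. destruct (classic (P r)) as [h | h]; [exact h|exfalso].
    assert (b <= r); [|lra]. apply lub. intros s [hs Ps].
    destruct (Rle_lt_dec s r) as [ | l]; [assumption|]. exfalso. apply h, Ps. lra. }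
  destruct (classic (P b)) as [Pb | nPb].
  + left. destruct (Pl b Pb) as [eps he].
    assert (near : forall s, 0 <= s < b + eps -> P s).
    { intros s hs. destruct (Rlt_le_dec s b) as [l | l]; [apply below; lra|].
      apply he. change (Rabs (s - b) < eps). rewrite Rabs_pos_eq; lra. }
    destruct (Rlt_le_dec T (b + eps)) as [l | l]; [intros r hr; apply near; lra|].
    exfalso. pose proof (cond_pos eps).
    assert (b + eps / 2 <= b); [|lra]. apply ub. split; [lra|].
    intros s hs. apply near. lra.
  + right. exists b. split; [|split; assumption].
    destruct (Req_dec b 0) as [-> | ]; [contradiction|lra].
Qed.

Lemma locally_lt (f g : R -> R) (r : R) :
  continuous f r -> continuous g r -> f r < g r -> locally r (fun x => f x < g x).
Proof.
intros fc gc h.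
assert (hc : continuous (fun x => g x - f x) r)
  by (apply (continuous_minus (V := R_NormedModule) g f); assumption).
assert (d : 0 < g r - f r) by lra.
generalize (proj1 (filterlim_locally (F := locally r) _ _) hc (mkposreal _ d)).
apply filter_imp. intros x hx.
change (Rabs (g x - f x - (g r - f r)) < g r - f r) in hx.
apply Rabs_def2 in hx. lra.
Qed.

(** * A priori bounds, uniqueness and existence for the reduced equation *)

Section Interior.

Variables (k c sigma a : R).
Hypotheses (hk : 0 < k < 1) (hc : 0 < c) (hs : 0 < sigma) (ha : 1 < a).

(* The equilibrium equation solved for [v']; the pressure is positive exactly when
   [sigma + 1 < sigma * u ^ 2 + v ^ 2]. *)
Definition vslope (r u v : R) : R :=
  2 * (u - v) * (v + k * (u - v)) / (r * v) - c * r * u ^ 5.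

(** The equations are asked on the open interval, since [vslope] is singular at the centre;
    continuity on [R] lets bounds pass to both ends. *)
Record interior_solution (b : R) (u v : R -> R) : Prop := {
  sol_u_cont : forall r, continuous u r;
  sol_v_cont : forall r, continuous v r;
  sol_u0 : u 0 = a;
  sol_v0 : v 0 = a;
  sol_u_pos : forall r, 0 < r < b -> 0 < u r;
  sol_v_pos : forall r, 0 < r < b -> 0 < v r;
  sol_du : forall r, 0 < r < b -> is_derive u r ((v r - u r) / r);
  sol_dv : forall r, 0 < r < b -> is_derive v r (vslope r (u r) (v r));
  sol_pressure : forall r, 0 < r < b -> sigma + 1 < sigma * u r ^ 2 + v r ^ 2
}.

(* Since [u > 1], for [r >= r_A] gravity makes
   [2 c r_A (r u) + v ^ 2 - c r_A r] nonincreasing; comparing with its value at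
   [r_A] bounds the radius by [r_max]. *)
Definition r_A : R := 1 + 4 * a ^ 2 / c.
Definition r_max : R := 2 * r_A * a + a ^ 2 / (c * r_A) + 1.
(* Where [v <= v_min] and [r <= r_max], the equation forces [v' > 0]. *)
Definition v_min : R := k / (2 * k + 4 * c * r_max ^ 2 * a ^ 5).

Lemma r_A_gt1 : 1 < r_A.
Proof.
unfold r_A. assert (0 < 4 * a ^ 2 / c) by (apply Rdiv_lt_0_compat; nra). lra.
Qed.

Lemma r_max_gt : r_A < r_max.
Proof.
pose proof r_A_gt1. unfold r_max.
assert (0 < a ^ 2 / (c * r_A)) by (apply Rdiv_lt_0_compat; nra). nra.
Qed.

Lemma v_min_pos : 0 < v_min.
Proof.
pose proof r_A_gt1. pose proof r_max_gt.
unfold v_min. apply Rdiv_lt_0_compat; [lra|].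
assert (0 < a ^ 5) by (apply pow_lt; lra).
assert (0 < r_max ^ 2) by (apply pow_lt; lra).
assert (0 < c * r_max ^ 2) by nra. nra.
Qed.

Lemma v_min_eq : v_min * (2 * k + 4 * c * r_max ^ 2 * a ^ 5) = k.
Proof.
pose proof r_A_gt1. pose proof r_max_gt.
assert (0 < a ^ 5) by (apply pow_lt; lra).
assert (0 < r_max ^ 2) by (apply pow_lt; lra).
assert (0 < c * r_max ^ 2) by nra. assert (0 < c * r_max ^ 2 * a ^ 5) by nra.
unfold v_min. field. lra.
Qed.

(** The numbers behind the lower barrier: if [v <= v_min <= 1 / 2] and [u > 1], then
    [2 (u - v) (v + k (u - v)) >= k / 2], while the gravity term [c r ^ 2 u ^ 5 v] stays below
    [k / 2]. *)
Lemma v_min_le : v_min <= 1 / 2 /\ c * r_max ^ 2 * a ^ 5 * v_min < k / 2.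
Proof.
pose proof r_A_gt1. pose proof r_max_gt. pose proof v_min_eq. pose proof v_min_pos.
assert (0 < a ^ 5) by (apply pow_lt; lra).
assert (0 < r_max ^ 2) by (apply pow_lt; lra).
assert (0 < c * r_max ^ 2) by nra. assert (0 < c * r_max ^ 2 * a ^ 5) by nra.
split; nra.
Qed.

(** * A priori bounds by barriers *)

Section Estimates.

Variables (b : R) (u v : R -> R).
Hypothesis (S : interior_solution b u v).

Let uc : forall r, continuous u r := sol_u_cont _ _ _ S.
Let vc : forall r, continuous v r := sol_v_cont _ _ _ S.

Lemma vslope_mul (r x y : R) : 0 < r -> 0 < y ->
  r * y * vslope r x y
  = 2 * (x - y) * (y + k * (x - y)) - c * r ^ 2 * x ^ 5 * y.
Proof. intros hr hy. unfold vslope. field. lra. Qed.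

(** Where [v >= u], multiplying the derivative of [v - u] by [r v] gives
    [-3 v (v - u) + 2 k (v - u) ^ 2] minus a positive gravity term; [k < 1] and [v - u < v] absorb
    the square. *)
Lemma sol_v_lt_u (r : R) : 0 < r < b -> v r < u r.
Proof.
intros hr.
cut (v r - u r < 0); [lra|].
revert r hr. apply (barrier (fun r => v r - u r)).
- intros r. cont.
- rewrite (sol_u0 _ _ _ S), (sol_v0 _ _ _ S). lra.
- intros r hr h.
  exists (vslope r (u r) (v r) - (v r - u r) / r). split.
  + apply (is_derive_minus (V := R_NormedModule)); [apply (sol_dv _ _ _ S r hr) | apply (sol_du _ _ _ S r hr)].
  + pose proof (sol_u_pos _ _ _ S r hr) as up.
    pose proof (sol_v_pos _ _ _ S r hr) as vp.
    apply (Rmult_lt_reg_l (r * v r)); [nra|].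
    rewrite Rmult_minus_distr_l, vslope_mul, Rmult_0_r by lra.
    replace (r * v r * ((v r - u r) / r)) with (v r * (v r - u r)) by (field; lra).
    assert (0 < c * r ^ 2 * u r ^ 5 * v r)
      by (repeat apply Rmult_lt_0_compat; try lra; apply pow_lt; lra).
    assert (k * (v r - u r) * (v r - u r) <= 1 * (v r - u r) * (v r - u r)).
    { apply Rmult_le_compat_r; [lra|]. apply Rmult_le_compat_r; lra. }
    nra.
Qed.

Lemma sol_u_lt_a (r : R) : 0 < r < b -> u r < a.
Proof.
intros hr.
cut (u r - a < 0); [lra|].
revert r hr. apply (barrier (fun r => u r - a)).
- intros r. cont.
- rewrite (sol_u0 _ _ _ S). lra.
- intros r hr h. pose proof (sol_du _ _ _ S r hr) as du.
  exists ((v r - u r) / r). split.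
  + auto_derive; [eexists; eassumption|]. rw_derive du. ring.
  + pose proof (sol_v_lt_u r hr).
    apply Ropp_lt_cancel. rewrite Ropp_0, <- Rdiv_opp_l.
    apply Rdiv_lt_0_compat; lra.
Qed.

Lemma sol_u_gt1 (r : R) : 0 < r < b -> 1 < u r.
Proof.
intros hr.
pose proof (sol_pressure _ _ _ S r hr). pose proof (sol_v_lt_u r hr).
pose proof (sol_u_pos _ _ _ S r hr). pose proof (sol_v_pos _ _ _ S r hr).
destruct (Rlt_le_dec 1 (u r)); [assumption|exfalso].
assert (u r ^ 2 <= 1) by nra. assert (v r ^ 2 <= u r ^ 2) by nra. nra.
Qed.

Lemma sol_v_range (r : R) : 0 < r < b -> 0 < v r < u r /\ 1 < u r < a.
Proof.
intros hr.
pose proof (sol_v_lt_u r hr). pose proof (sol_u_lt_a r hr).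
pose proof (sol_u_gt1 r hr). pose proof (sol_v_pos _ _ _ S r hr). lra.
Qed.

Lemma sol_r_lt (r : R) : 0 < r < b -> r < r_max.
Proof.
intros hr.
pose proof r_A_gt1 as hA. pose proof r_max_gt as hM.
destruct (Rle_lt_dec r r_A) as [h | h]; [lra|].
assert (cA : 4 * a ^ 2 / r_A <= c * r_A).
{ apply (Rmult_le_reg_r r_A); [lra|].
  replace (4 * a ^ 2 / r_A * r_A) with (c * (4 * a ^ 2 / c)) by (field; lra).
  assert (4 * a ^ 2 / c <= r_A) by (unfold r_A; lra).
  assert (0 < c * r_A) by nra.
  apply Rle_trans with (c * r_A); [apply Rmult_le_compat_l; lra|nra]. }
set (N := 2 * c * r_A).
(* As [(x u)' = v], the first term contributes [N v]. Gravity contributes at most [- N v] through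
   [(v ^ 2)'], because [u > 1] and [x >= r_A]. What remains is at most
   [4 a ^ 2 / x - c r_A <= 0]. *)
set (F := fun x => N * (x * u x) + v x ^ 2 - c * r_A * x).
assert (FF : F r <= F r_A).
{ apply decreasing_of_derive; [lra|]. intros x hx.
  assert (hx' : 0 < x < b) by lra.
  pose proof (sol_dv _ _ _ S x hx') as dv. pose proof (sol_du _ _ _ S x hx') as du.
  exists (N * v x + 2 * v x * vslope x (u x) (v x) - c * r_A). split.
  - unfold F. auto_derive; [split; [eexists; eassumption|split; [eexists; eassumption|exact I]]|].
    rw_derive dv; rw_derive du. field. lra.
  - destruct (sol_v_range x hx') as [h1 h2].
    assert (e := vslope_mul x (u x) (v x) ltac:(lra) ltac:(lra)).
    assert (u5 : 1 < u x ^ 5) by (apply Rlt_pow_R1; [lra|auto with arith]).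
    assert (b1 : (u x - v x) * (v x + k * (u x - v x)) <= a * a).
    { apply Rmult_le_compat; nra. }
    assert (b2 : 2 * c * r_A * v x * x <= 2 * (c * x ^ 2 * u x ^ 5 * v x)).
    { assert (r_A * x <= x ^ 2 * u x ^ 5) by (assert (0 < x * x) by nra; nra).
      assert (0 < c * v x) by nra. nra. }
    apply (Rmult_le_reg_l x); [lra|].
    assert (4 * a ^ 2 <= c * r_A * x).
    { apply Rle_trans with (4 * a ^ 2 / r_A * r_A); [right; field; lra|].
      apply Rmult_le_compat; try lra. apply Rle_mult_inv_pos; nra. }
    unfold N. nra. }
unfold F in FF.
assert (0 < r_A < b) by lra.
destruct (sol_v_range r hr) as [h1 h2].
destruct (sol_v_range r_A H) as [h3 h4].
(* Since [u r > 1] and [N = 2 c r_A], the first term of [F r] is at least twice the subtracted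
   [c r_A r]. *)
assert (N * r <= N * (r * u r)) by (unfold N; apply Rmult_le_compat_l; nra).
assert (N * (r_A * u r_A) <= N * (r_A * a)) by (unfold N; apply Rmult_le_compat_l; nra).
assert (v r_A ^ 2 <= a ^ 2) by nra.
assert (0 <= v r ^ 2) by nra.
assert (B : c * r_A * r <= N * (r_A * a) + a ^ 2) by (unfold N in *; nra).
assert (r <= 2 * r_A * a + a ^ 2 / (c * r_A)); [|unfold r_max; lra].
apply (Rmult_le_reg_l (c * r_A)); [nra|].
replace (c * r_A * (2 * r_A * a + a ^ 2 / (c * r_A))) with (N * (r_A * a) + a ^ 2)
  by (unfold N; field; lra).
exact B.
Qed.

Lemma sol_v_gt (r : R) : 0 < r < b -> v_min < v r.
Proof.
intros hr.
cut (v_min - v r < 0); [lra|].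
pose proof v_min_pos as vp. destruct v_min_le as [v1 v2].
revert r hr. apply (barrier (fun r => v_min - v r)).
- intros r. cont.
- rewrite (sol_v0 _ _ _ S). lra.
- intros r hr h.
  pose proof (sol_dv _ _ _ S r hr) as dv.
  exists (- vslope r (u r) (v r)). split.
  + auto_derive; [eexists; eassumption|]. rw_derive dv. ring.
  + destruct (sol_v_range r hr) as [h1 h2].
    pose proof (sol_r_lt r hr).
    assert (e := vslope_mul r (u r) (v r) ltac:(lra) ltac:(lra)).
    assert (u5 : 0 < u r ^ 5 <= a ^ 5)
      by (split; [apply pow_lt; lra|apply pow_incr; lra]).
    assert (r2 : 0 < r ^ 2 <= r_max ^ 2)
      by (split; [apply pow_lt; lra|apply pow_incr; lra]).
    assert (c * r ^ 2 * u r ^ 5 * v r <= c * r_max ^ 2 * a ^ 5 * v_min).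
    { apply Rmult_le_compat; try lra; [apply Rmult_le_pos; nra|].
      apply Rmult_le_compat; nra. }
    assert (2 * (1 / 2) * (k * (1 / 2)) <= 2 * (u r - v r) * (v r + k * (u r - v r))).
    { apply Rmult_le_compat; nra. }
    apply (Rmult_lt_reg_l (r * v r)); nra.
Qed.

(** In terms of [y = (v - u) / r] this is [y > - c a ^ 5 r]: it forces [y] to vanish at the centre,
    as uniqueness needs, and supplies the clipping level for [y]. *)
Lemma sol_v_gt_u_sub (r : R) : 0 < r < b -> u r - c * a ^ 5 * r ^ 2 < v r.
Proof.
intros hr.
cut (u r - v r - c * a ^ 5 * r ^ 2 < 0); [lra|].
revert r hr. apply (barrier (fun r => u r - v r - c * a ^ 5 * r ^ 2)).
- intros r. cont.
- rewrite (sol_v0 _ _ _ S), (sol_u0 _ _ _ S). lra.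
- intros r hr h.
  pose proof (sol_dv _ _ _ S r hr) as dv. pose proof (sol_du _ _ _ S r hr) as du.
  exists ((v r - u r) / r - vslope r (u r) (v r) - 2 * c * a ^ 5 * r). split.
  + auto_derive; [split; [eexists; eassumption|split; [eexists; eassumption|exact I]]|].
    rw_derive dv; rw_derive du. ring.
  + destruct (sol_v_range r hr) as [h1 h2].
    assert (u5 : 0 < u r ^ 5 <= a ^ 5)
      by (split; [apply pow_lt; lra|apply pow_incr; lra]).
    set (w := u r - v r) in *.
    assert (e : r * ((v r - u r) / r - vslope r (u r) (v r) - 2 * c * a ^ 5 * r)
      = - 3 * w - 2 * k * w ^ 2 / v r + c * r ^ 2 * u r ^ 5 - 2 * c * a ^ 5 * r ^ 2).
    { unfold vslope, w. field. lra. }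
    assert (0 <= 2 * k * w ^ 2 / v r) by (apply Rle_mult_inv_pos; nra).
    assert (0 < c * r ^ 2) by (apply Rmult_lt_0_compat; [lra|apply pow_lt; lra]).
    apply (Rmult_lt_reg_l r); [lra|]. rewrite e. nra.
Qed.

(* A quantitative form of [v < u] that survives at the surface. *)
Lemma sol_gap : exists eps, 0 < eps /\ forall r, 0 < r < b -> v r < u r - eps * r ^ 2.
Proof.
pose proof v_min_pos as vp. pose proof r_A_gt1. pose proof r_max_gt.
(* Where the gap fails, [w = u - v <= eps r ^ 2]. Then [3 w], [2 eps r ^ 2] and the quadratic term,
   controlled by [B], add up to at most [eps (5 + 2 B) r ^ 2], and [eps] is chosen to keep this
   below the gravity term. *)
set (B := r_max ^ 2 / v_min).
assert (Bp : 0 < B) by (apply Rdiv_lt_0_compat; nra).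
set (eps := c / (c + 5 + 2 * B)).
assert (ep : 0 < eps) by (apply Rdiv_lt_0_compat; lra).
assert (ee : eps * (c + 5 + 2 * B) = c) by (unfold eps; field; lra).
exists eps. split; [exact ep|].
intros r hr.
cut (v r - u r + eps * r ^ 2 < 0); [lra|].
revert r hr. apply (barrier (fun r => v r - u r + eps * r ^ 2)).
- intros r. cont.
- rewrite (sol_v0 _ _ _ S), (sol_u0 _ _ _ S). lra.
- intros r hr h.
  pose proof (sol_dv _ _ _ S r hr) as dv. pose proof (sol_du _ _ _ S r hr) as du.
  exists (vslope r (u r) (v r) - (v r - u r) / r + 2 * eps * r). split.
  + auto_derive; [split; [eexists; eassumption|split; [eexists; eassumption|exact I]]|].
    rw_derive dv; rw_derive du. ring.
  + destruct (sol_v_range r hr) as [h1 h2].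
    pose proof (sol_v_gt r hr). pose proof (sol_r_lt r hr).
    assert (u5 : 1 < u r ^ 5) by (apply Rlt_pow_R1; [lra|auto with arith]).
    set (w := u r - v r) in *.
    assert (e : r * (vslope r (u r) (v r) - (v r - u r) / r + 2 * eps * r)
      = 3 * w + 2 * k * w ^ 2 / v r - c * r ^ 2 * u r ^ 5 + 2 * eps * r ^ 2).
    { unfold vslope, w. field. lra. }
    assert (hw : 0 < w <= eps * r ^ 2) by (unfold w in *; lra).
    assert (q : 2 * k * w ^ 2 / v r <= 2 * eps * r ^ 2 * B).
    { apply Rle_trans with (2 * (eps * r ^ 2) * (r_max ^ 2) / v_min);
        [|right; unfold B; field; lra].
      unfold Rdiv. apply Rmult_le_compat.
      - nra.
      - left. apply Rinv_0_lt_compat. lra.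
      - assert (eps < 1) by nra.
        assert (r ^ 2 <= r_max ^ 2) by (apply pow_incr; lra).
        assert (w * w <= (eps * r ^ 2) * (r_max ^ 2)).
        { apply Rmult_le_compat; try lra. nra. }
        nra.
      - apply Rinv_le_contravar; lra. }
    apply (Rmult_lt_reg_l r); [lra|]. rewrite e.
    assert (0 < r ^ 2) by nra.
    assert (c * r ^ 2 < c * r ^ 2 * u r ^ 5) by (assert (0 < c * r ^ 2) by nra; nra).
    nra.
Qed.

End Estimates.

(* The right-hand side of the equation for [y = (v - u) / r], apart from its singular
   term [- 4 y / r], with the arguments clipped so as to be globally Lipschitz. *)
Definition slope (T U Y v0 r u y : R) : R :=
  2 * k * clip (- Y) Y y ^ 2
    / Rmax v0 (clip 0 U u + clip 0 T r * clip (- Y) Y y)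
  - c * clip 0 U u ^ 5.

Lemma slope_eq (T U Y v0 r u y : R) :
  0 <= u <= U -> - Y <= y <= Y -> 0 <= r <= T -> v0 <= u + r * y ->
  slope T U Y v0 r u y = 2 * k * y ^ 2 / (u + r * y) - c * u ^ 5.
Proof.
intros hu hy hr hv. unfold slope.
rewrite !clip_id, Rmax_right by assumption. reflexivity.
Qed.

Lemma slope_lipschitz (T U Y v0 : R) : 0 <= T -> 0 <= U -> 0 <= Y -> 0 < v0 ->
  exists L, 0 <= L /\ forall r u y u' y',
    Rabs (slope T U Y v0 r u y - slope T U Y v0 r u' y')
      <= L * (Rabs (u - u') + Rabs (y - y')).
Proof.
intros hT hU hY hv.
(* [L1] is the product rule for [q ^ 2 * / m] with [m >= v0], where [1 + T] bounds the variation of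
   [m]; [L2] comes from the fifth power. *)
set (L1 := 2 * k * ((Y * Y) * ((1 + T) / (v0 * v0)) + / v0 * (Y + Y))).
set (L2 := c * (5 * U ^ 4)).
exists (L1 + L2).
assert (iv : 0 < / v0) by now apply Rinv_0_lt_compat.
assert (hL1 : 0 <= L1).
{ unfold L1. assert (0 <= (1 + T) / (v0 * v0)) by (apply Rle_mult_inv_pos; nra).
  apply Rmult_le_pos; [lra|]. apply Rplus_le_le_0_compat; apply Rmult_le_pos; nra. }
assert (hL2 : 0 <= L2).
{ unfold L2. assert (0 <= U ^ 4) by (apply pow_le; lra). nra. }
split; [lra|]. intros r u y u' y'. unfold slope.
pose proof (clip_range 0 U u hU) as hcu. pose proof (clip_range 0 U u' hU) as hcu'.
pose proof (clip_range (- Y) Y y ltac:(lra)) as hcy.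
pose proof (clip_range (- Y) Y y' ltac:(lra)) as hcy'.
pose proof (clip_range 0 T r hT) as hcr.
pose proof (clip_lipschitz 0 U u u') as du.
pose proof (clip_lipschitz (- Y) Y y y') as dy.
set (p := clip 0 U u) in *. set (p' := clip 0 U u') in *.
set (q := clip (- Y) Y y) in *. set (q' := clip (- Y) Y y') in *.
set (t := clip 0 T r) in *.
set (D := Rabs (u - u') + Rabs (y - y')).
pose proof (Rabs_pos (u - u')). pose proof (Rabs_pos (y - y')).
assert (dp : Rabs (p - p') <= D) by (unfold D; lra).
assert (dq : Rabs (q - q') <= D) by (unfold D; lra).
assert (D0 : 0 <= D) by (unfold D; lra).
set (m := Rmax v0 (p + t * q)). set (m' := Rmax v0 (p' + t * q')).
assert (mv : v0 <= m) by apply Rmax_l. assert (mv' : v0 <= m') by apply Rmax_l.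
assert (dm : Rabs (m - m') <= (1 + T) * D).
{ apply Rle_trans with (Rabs ((p + t * q) - (p' + t * q'))).
  - unfold m, m', Rmax, Rabs. repeat destruct Rle_dec; repeat destruct Rcase_abs; lra.
  - replace (p + t * q - (p' + t * q')) with ((p - p') + t * (q - q')) by ring.
    eapply Rle_trans; [apply Rabs_triang|]. rewrite Rabs_mult, (Rabs_pos_eq t) by lra.
    assert (t * Rabs (q - q') <= T * D)
      by (apply Rmult_le_compat; try lra; apply Rabs_pos).
    lra. }
assert (di : Rabs (/ m - / m') <= (1 + T) / (v0 * v0) * D).
{ replace (/ m - / m') with ((m' - m) * / (m * m')) by (field; lra).
  rewrite Rabs_mult, Rabs_minus_sym, (Rabs_pos_eq (/ _)).
  2: left; apply Rinv_0_lt_compat; nra.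
  replace ((1 + T) / (v0 * v0) * D) with ((1 + T) * D * / (v0 * v0)) by (field; lra).
  apply Rmult_le_compat; [apply Rabs_pos|left; apply Rinv_0_lt_compat; nra|exact dm|].
  apply Rinv_le_contravar; nra. }
assert (dqq : Rabs (q * q - q' * q') <= Y * D + Y * D).
{ apply Rabs_le_sub_mul; try assumption; apply Rabs_le; lra. }
assert (A1 : Rabs ((q * q) * / m - (q' * q') * / m')
   <= (Y * Y) * ((1 + T) / (v0 * v0) * D) + / v0 * (Y * D + Y * D)).
{ apply Rabs_le_sub_mul; try assumption.
  - apply Rabs_le; nra.
  - rewrite Rabs_pos_eq; [apply Rinv_le_contravar; lra|].
    left; apply Rinv_0_lt_compat; lra. }
assert (U0 : forall n, 0 <= U ^ n) by (intros; apply pow_le; lra).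
assert (A2 : forall n, Rabs (p ^ n - p' ^ n) <= INR n * U ^ (pred n) * D).
{ assert (aux : forall n, Rabs (p ^ S n - p' ^ S n) <= INR (S n) * U ^ n * D).
  - induction n as [|n IH].
    + simpl. rewrite !Rmult_1_r, Rmult_1_l. exact dp.
    + change (p ^ S (S n)) with (p * p ^ S n). change (p' ^ S (S n)) with (p' * p' ^ S n).
      eapply Rle_trans.
      * apply Rabs_le_sub_mul with (B := U) (C := U ^ S n); [| |exact dp|exact IH].
        -- apply Rabs_le; lra.
        -- rewrite Rabs_pos_eq by (apply pow_le; lra). apply pow_incr; lra.
      * right. rewrite (S_INR (S n)). simpl (U ^ S n). ring.
  - intros [|n]; [simpl; rewrite Rminus_diag, Rabs_R0; lra|apply aux]. }
specialize (A2 5%nat). simpl pred in A2.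
replace (INR 5) with 5 in A2 by (simpl; ring).
replace (2 * k * q ^ 2 / m - c * p ^ 5 - (2 * k * q' ^ 2 / m' - c * p' ^ 5))
  with (2 * k * ((q * q) * / m - (q' * q') * / m') - c * (p ^ 5 - p' ^ 5))
  by (field; lra).
eapply Rle_trans; [apply Rabs_triang|].
rewrite Rabs_Ropp, !(Rabs_mult (_ * k)), (Rabs_mult c), (Rabs_pos_eq (2 * k)), (Rabs_pos_eq c) by lra.
replace ((L1 + L2) * D) with
 (2 * k * (Y * Y * ((1 + T) / (v0 * v0) * D) + / v0 * (Y * D + Y * D)) + c * (5 * U ^ 4 * D))
 by (unfold L1, L2; ring).
apply Rplus_le_compat; apply Rmult_le_compat_l; lra.
Qed.

Lemma slope_bounded (T U Y v0 : R) : 0 <= U -> 0 <= Y -> 0 < v0 ->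
  exists M, 0 <= M /\ forall r u y, Rabs (slope T U Y v0 r u y) <= M.
Proof.
intros hU hY hv. exists (2 * k * Y ^ 2 / v0 + c * U ^ 5).
assert (0 <= U ^ 5) by (apply pow_le; lra).
assert (0 <= 2 * k * Y ^ 2 / v0) by (apply Rle_mult_inv_pos; nra).
split; [nra|]. intros r u y. unfold slope.
pose proof (clip_range 0 U u hU) as hcu.
pose proof (clip_range (- Y) Y y ltac:(lra)) as hcy.
set (m := Rmax _ _). assert (v0 <= m) by apply Rmax_l.
assert (0 <= clip 0 U u ^ 5 <= U ^ 5) by (split; [apply pow_le|apply pow_incr]; lra).
assert (0 <= 2 * k * clip (- Y) Y y ^ 2 / m <= 2 * k * Y ^ 2 / v0).
{ assert (0 <= clip (- Y) Y y ^ 2 <= Y ^ 2).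
  { split; [apply pow2_ge_0|]. apply pow_maj_Rabs, Rabs_le, hcy. }
  split; [apply Rle_mult_inv_pos; [apply Rmult_le_pos|]; lra|].
  apply Rmult_le_compat.
  - apply Rmult_le_pos; lra.
  - left; apply Rinv_0_lt_compat; lra.
  - apply Rmult_le_compat_l; lra.
  - apply Rinv_le_contravar; lra. }
assert (0 <= c * clip 0 U u ^ 5 <= c * U ^ 5)
  by (split; [apply Rmult_le_pos|apply Rmult_le_compat_l]; lra).
apply Rabs_le. lra.
Qed.

Lemma continuous_slope (T U Y v0 : R) (u y : R -> R) (r : R) : 0 < v0 ->
  (forall r, continuous u r) -> (forall r, continuous y r) ->
  continuous (fun s => slope T U Y v0 s (u s) (y s)) r.
Proof.
intros hv uc yc. unfold slope. cont.
match goal with |- Rmax ?x ?y <> 0 => pose proof (Rmax_l x y) end. lra.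
Qed.

(* The difference of two solutions, measured by [u] and [y = (v - u) / r]:
   the singular term [- 4 y / r] of the equation for [y] has the good sign. *)
Lemma sol_unique (b1 b2 : R) (u1 v1 u2 v2 : R -> R) :
  interior_solution b1 u1 v1 -> interior_solution b2 u2 v2 ->
  forall r, 0 < r < b1 -> r < b2 -> u1 r = u2 r /\ v1 r = v2 r.
Proof.
intros S1 S2 r0 hr0 hr02.
pose proof r_A_gt1. pose proof r_max_gt. pose proof v_min_pos as vm.
assert (a5 : 0 < a ^ 5) by (apply pow_lt; lra).
set (Y := c * a ^ 5 * r_max).
assert (ca : 0 < c * a ^ 5) by (apply Rmult_lt_0_compat; lra).
assert (hY : 0 <= Y) by (unfold Y; apply Rmult_le_pos; lra).
destruct (slope_lipschitz r_max a Y v_min) as [L [L0 hL]]; try lra.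
(* The derivative of the squared distance is at most [e ^ 2 + d ^ 2 + 2 L (|d| |e| + d ^ 2)], hence
   at most [C (e ^ 2 + d ^ 2)]. *)
set (C := 1 + 3 * L).
assert (props : forall b u v, interior_solution b u v -> forall r, 0 < r < b ->
  is_derive (fun r => (v r - u r) / r) r
    (slope r_max a Y v_min r (u r) ((v r - u r) / r) - 4 / r * ((v r - u r) / r))
  /\ - (c * a ^ 5 * r) <= (v r - u r) / r <= 0).
{ intros b u v S r hr.
  destruct (sol_v_range _ _ _ S r hr) as [h1 h2].
  pose proof (sol_v_gt _ _ _ S r hr). pose proof (sol_r_lt _ _ _ S r hr).
  pose proof (sol_v_gt_u_sub _ _ _ S r hr).
  pose proof (sol_dv _ _ _ S r hr) as dv. pose proof (sol_du _ _ _ S r hr) as du.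
  assert (hy : - (c * a ^ 5 * r) <= (v r - u r) / r <= 0).
  { split; apply (Rmult_le_reg_l r); try lra;
    replace (r * ((v r - u r) / r)) with (v r - u r) by (field; lra); nra. }
  split; [|exact hy].
  assert (- Y <= (v r - u r) / r <= Y).
  { assert (c * a ^ 5 * r <= Y) by (unfold Y; apply Rmult_le_compat_l; lra). lra. }
  rewrite slope_eq; try lra.
  2: { replace (u r + r * ((v r - u r) / r)) with (v r) by (field; lra). lra. }
  auto_derive.
  - repeat split; try (eexists; eassumption). lra.
  - rw_derive dv. rw_derive du. unfold vslope. field.
    split; [lra|]. replace (u r + (v r - u r)) with (v r) by ring. lra. }
pose proof (props _ _ _ S1) as P1. pose proof (props _ _ _ S2) as P2. clear props.
set (y1 := fun r => (v1 r - u1 r) / r) in *. set (y2 := fun r => (v2 r - u2 r) / r) in *.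
set (E := fun r => ((u1 r - u2 r) ^ 2 + (y1 r - y2 r) ^ 2) * exp (- C * r)).
assert (Edec : forall s, 0 < s < r0 -> E r0 <= E s).
{ intros s hs0. apply decreasing_of_derive; [lra|]. intros r hr.
  assert (h1 : 0 < r < b1) by lra. assert (h2 : 0 < r < b2) by lra.
  destruct (P1 r h1) as [dy1 _]. destruct (P2 r h2) as [dy2 _].
  pose proof (sol_du _ _ _ S1 r h1) as du1. pose proof (sol_du _ _ _ S2 r h2) as du2.
  change ((v1 r - u1 r) / r) with (y1 r) in *.
  change ((v2 r - u2 r) / r) with (y2 r) in *.
  specialize (hL r (u1 r) (y1 r) (u2 r) (y2 r)).
  set (F1 := slope _ _ _ _ r (u1 r) (y1 r)) in *.
  set (F2 := slope _ _ _ _ r (u2 r) (y2 r)) in *.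
  change (is_derive y1 r (F1 - 4 / r * y1 r)) in dy1.
  change (is_derive y2 r (F2 - 4 / r * y2 r)) in dy2.
  set (e := u1 r - u2 r) in *. set (d := y1 r - y2 r) in *.
  exists (exp (- C * r) * (2 * e * d + 2 * d * (F1 - F2) - 8 / r * d ^ 2 - C * (e ^ 2 + d ^ 2))).
  split.
  - unfold E. auto_derive.
    + repeat split; eexists; eassumption.
    + rw_derive du1. rw_derive du2. rw_derive dy1. rw_derive dy2.
      unfold e, d. field. lra.
  - assert (0 <= 8 / r * d ^ 2).
    { apply Rmult_le_pos; [left; apply Rdiv_lt_0_compat; lra|nra]. }
    assert (B : d * (F1 - F2) <= Rabs d * (L * (Rabs e + Rabs d))).
    { eapply Rle_trans; [apply Rle_abs|]. rewrite Rabs_mult.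
      apply Rmult_le_compat_l; [apply Rabs_pos|exact hL]. }
    assert (e ^ 2 = Rabs e ^ 2) by (symmetry; apply pow2_abs).
    assert (d ^ 2 = Rabs d ^ 2) by (symmetry; apply pow2_abs).
    assert (2 * e * d <= e ^ 2 + d ^ 2) by (pose proof (pow2_ge_0 (e - d)); nra).
    assert (L * (2 * (Rabs d * Rabs e)) <= L * (Rabs e ^ 2 + Rabs d ^ 2)).
    { apply Rmult_le_compat_l; [lra|]. pose proof (pow2_ge_0 (Rabs e - Rabs d)); nra. }
    assert (0 <= L * Rabs e ^ 2) by (apply Rmult_le_pos; [lra|apply pow2_ge_0]).
    assert (2 * e * d + 2 * d * (F1 - F2) - 8 / r * d ^ 2 - C * (e ^ 2 + d ^ 2) <= 0)
      by (unfold C; nra).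
    pose proof (exp_pos (- C * r)). nra. }
(* Near the centre both [y1] and [y2] lie in [[- c a ^ 5 s, 0]], so [E s] has a continuous majorant
   that vanishes at [0]. *)
assert (E0 : E r0 <= 0).
{ replace 0 with ((u1 0 - u2 0) ^ 2 + (c * a ^ 5 * 0) ^ 2) at 1.
  2: { rewrite (sol_u0 _ _ _ S1), (sol_u0 _ _ _ S2). ring. }
  pose proof (sol_u_cont _ _ _ S1) as u1c. pose proof (sol_u_cont _ _ _ S2) as u2c.
  apply (le_of_le_right (fun _ => E r0)
    (fun r => (u1 r - u2 r) ^ 2 + (c * a ^ 5 * r) ^ 2) 0 r0); [lra|cont|cont|].
  intros s hs0. eapply Rle_trans; [apply Edec; exact hs0|].
  destruct (P1 s ltac:(lra)) as [_ q1]. destruct (P2 s ltac:(lra)) as [_ q2].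
  unfold E. change ((v1 s - u1 s) / s) with (y1 s) in q1.
  change ((v2 s - u2 s) / s) with (y2 s) in q2.
  assert (ex : 0 < exp (- C * s) <= 1).
  { split; [apply exp_pos|]. rewrite <- exp_0.
    destruct (Req_dec (- C * s) 0) as [-> | ]; [lra|].
    left. apply exp_increasing. assert (0 < C * s) by (unfold C; nra). lra. }
  assert ((y1 s - y2 s) ^ 2 <= (c * a ^ 5 * s) ^ 2) by (apply pow_maj_Rabs, Rabs_le; lra).
  pose proof (pow2_ge_0 (u1 s - u2 s)). pose proof (pow2_ge_0 (y1 s - y2 s)). nra. }
unfold E in E0. pose proof (exp_pos (- C * r0)).
assert (Z : (u1 r0 - u2 r0) ^ 2 + (y1 r0 - y2 r0) ^ 2 <= 0) by nra.
pose proof (pow2_ge_0 (u1 r0 - u2 r0)). pose proof (pow2_ge_0 (y1 r0 - y2 r0)).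
assert (Z1 : u1 r0 - u2 r0 = 0) by (apply Rsqr_0_uniq; rewrite Rsqr_pow2; lra).
assert (Z2 : y1 r0 - y2 r0 = 0) by (apply Rsqr_0_uniq; rewrite Rsqr_pow2; lra).
split; [lra|]. unfold y1, y2 in Z2.
assert (v1 r0 - u1 r0 = v2 r0 - u2 r0); [|lra].
apply (Rmult_eq_reg_r (/ r0)); [|apply Rinv_neq_0_compat; lra].
unfold Rdiv in Z2. lra.
Qed.

(* Solve the clipped equation on [[0, r_max + 1]] and stop when the pressure vanishes
   or a clip becomes active: the a priori bounds exclude the latter. *)
Lemma sol_exists : exists b u v y, 0 < b /\ interior_solution b u v
  /\ sigma * u b ^ 2 + v b ^ 2 = sigma + 1
  /\ 1 <= u b /\ 0 < v b
  /\ (forall r, continuous y r)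
  /\ (forall r, is_derive u r (y r))
  /\ (forall r, v r = u r + r * y r).
Proof.
pose proof r_A_gt1 as hA. pose proof r_max_gt as hM.
pose proof v_min_pos as vm.
pose proof v_min_le as vm2.
assert (a5 : 0 < a ^ 5) by (apply pow_lt; lra).
assert (ca : 0 < c * a ^ 5) by (apply Rmult_lt_0_compat; lra).
(* Each level leaves room beyond the a priori bound: a solution on all of [(0, T)] contradicts
   [sol_r_lt], and at the exit point no clip can be the condition that fails. *)
set (T := r_max + 1). set (U := a + 1). set (v0 := v_min / 2).
set (Y := c * a ^ 5 * T + 1).
assert (hT : 0 < T) by (unfold T; lra).
assert (hY : 1 <= Y) by (unfold Y; assert (0 < c * a ^ 5 * T) by (apply Rmult_lt_0_compat; lra); lra).
destruct (slope_lipschitz T U Y v0) as [L [L0 hL]]; try (unfold U, v0; lra).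
destruct (slope_bounded T U Y v0) as [M [M0 hMb]]; try (unfold U, v0; lra).
destruct (singular_picard T a L M (slope T U Y v0) hT L0 M0 hL) as
  [u [y [yc [u0 [y0 [du dy]]]]]].
{ exact hMb. }
{ intros u y uc yc r. apply continuous_slope; try assumption. unfold v0; lra. }
set (v := fun r => u r + r * y r).
assert (uc : forall r, continuous u r).
{ intros r. apply (ex_derive_continuous u). exists (y r). apply du. }
assert (vc : forall r, continuous v r) by (intros r; unfold v; cont).
set (P := fun r => sigma + 1 < sigma * u r ^ 2 + v r ^ 2 /\ v0 < v r /\
   0 < u r /\ u r < U /\ - Y < y r /\ y r < Y).
assert (sol : forall b, 0 < b <= T -> (forall r, 0 <= r < b -> P r) ->
  interior_solution b u v).
{ intros b hb hP. constructor; try assumption.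
  - unfold v. rewrite u0. ring.
  - intros r hr. apply (hP r ltac:(lra)).
  - intros r hr. destruct (hP r ltac:(lra)) as [_ [h _]]. unfold v0 in h. lra.
  - intros r hr. replace ((v r - u r) / r) with (y r) by (unfold v; field; lra). apply du.
  - intros r hr. destruct (hP r ltac:(lra)) as [_ [h1 [h2 [h3 [h4 h5]]]]].
    assert (0 < v r) by (unfold v0 in h1; lra).
    specialize (dy r ltac:(lra)). specialize (du r).
    rewrite slope_eq in dy; try (unfold v in h1; lra).
    unfold v at 1. auto_derive.
    + repeat split; eexists; eassumption.
    + rw_derive du. rw_derive dy. unfold vslope, v in *. field. lra.
  - intros r hr. apply (hP r ltac:(lra)). }
destruct (first_exit P T hT) as [all | [b [hb [nP below]]]].
- unfold P, v. rewrite u0, y0, Rmult_0_l, Rplus_0_r. unfold U, v0.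
  assert (1 < a ^ 2) by nra. repeat split; try lra. nra.
- intros r [h1 [h2 [h3 [h4 [h5 h6]]]]].
  repeat apply filter_and.
  + apply (locally_lt (fun _ => sigma + 1) (fun r => sigma * u r ^ 2 + v r ^ 2)); [cont|cont|exact h1].
  + apply (locally_lt (fun _ => v0) v); [cont|cont|exact h2].
  + apply (locally_lt (fun _ => 0) u); [cont|cont|exact h3].
  + apply (locally_lt u (fun _ => U)); [cont|cont|exact h4].
  + apply (locally_lt (fun _ => - Y) y); [cont|cont|exact h5].
  + apply (locally_lt y (fun _ => Y)); [cont|cont|exact h6].
- exfalso.
  assert (S : interior_solution T u v) by (apply sol; [lra|]; intros r hr; apply all; lra).
  pose proof (sol_r_lt T u v S r_max ltac:(unfold T; lra)). lra.
- assert (S : interior_solution b u v) by (apply sol; assumption).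
  pose proof (sol_v_range b u v S) as range.
  assert (ub1 : 1 <= u b).
  { apply (le_of_le_left (fun _ => 1) u 0 b); [lra|cont|cont|].
    intros r hr. destruct (range r hr). lra. }
  assert (uba : u b <= a).
  { apply (le_of_le_left u (fun _ => a) 0 b); [lra|cont|cont|].
    intros r hr. destruct (range r hr). lra. }
  assert (vb : v_min <= v b).
  { apply (le_of_le_left (fun _ => v_min) v 0 b); [lra|cont|cont|].
    intros r hr. left. apply (sol_v_gt b u v S r hr). }
  assert (yb : y b <= 0).
  { apply (le_of_le_left y (fun _ => 0) 0 b); [lra|cont|cont|].
    intros r hr. destruct (range r hr) as [h _]. unfold v in h. nra. }
  assert (yb2 : - (c * a ^ 5 * b) <= y b).
  { apply (le_of_le_left (fun r => - (c * a ^ 5 * r)) y 0 b); [lra|cont|cont|].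
    intros r hr. pose proof (sol_v_gt_u_sub b u v S r hr) as h.
    unfold v in h. apply (Rmult_le_reg_l r); [lra|]. nra. }
  assert (c * a ^ 5 * b <= c * a ^ 5 * T) by (apply Rmult_le_compat_l; lra).
  exists b, u, v, y. split; [lra|]. split; [exact S|].
  split; [|split; [exact ub1|split; [lra|split; [exact yc|split; [exact du|reflexivity]]]]].
  (* If the pressure were still positive at [b], all clauses of [P b] would hold; the converse
     inequality is the limit from inside. *)
  apply Rle_antisym.
  + apply Rnot_lt_le. intros h. apply nP.
    repeat split; try assumption; unfold U, v0, Y in *; lra.
  + apply (le_of_le_left (fun _ => sigma + 1) (fun r => sigma * u r ^ 2 + v r ^ 2) 0 b);
      [lra|cont|cont|].
    intros r hr. left. apply (sol_pressure _ _ _ S r hr).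
Qed.

End Interior.

(** * Balls of Seth matter *)

Lemma Rpower_cube (u p : R) : 0 < u -> Rpower (u ^ 3) p = Rpower u (3 * p).
Proof.
intros hu. rewrite <- (Rpower_pow 3 u hu), Rpower_mult. f_equal. simpl. ring.
Qed.

Lemma Rpower_cube_1_3 (u : R) : 0 < u -> Rpower (u ^ 3) (1 / 3) = u.
Proof.
intros hu. rewrite Rpower_cube by assumption.
replace (3 * (1 / 3)) with 1 by field. now apply Rpower_1.
Qed.

Lemma Rpower_cube_2_3 (u : R) : 0 < u -> Rpower (u ^ 3) (2 / 3) = u ^ 2.
Proof.
intros hu. rewrite Rpower_cube by assumption. rewrite <- (Rpower_pow 2 u hu).
f_equal. simpl. field.
Qed.

Lemma Rpower_cube_m4_3 (u : R) : 0 < u -> Rpower (u ^ 3) (- (4 / 3)) = / u ^ 4.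
Proof.
intros hu. rewrite Rpower_cube by assumption.
rewrite <- (Rpower_pow 4 u hu), <- Rpower_Ropp. f_equal. simpl. field.
Qed.

Lemma Rpower_1_3_cube (x : R) : 0 < x -> Rpower x (1 / 3) ^ 3 = x.
Proof.
intros hx. rewrite <- Rpower_pow by apply exp_pos. rewrite Rpower_mult.
replace (1 / 3 * INR 3) with 1 by (simpl; field). now apply Rpower_1.
Qed.

(** Removes the possible jump of a ball profile at its surface: the profile is continued by its end
    values before calculus is applied. *)
Lemma continuous_on_clip (lo hi : R) (f : R -> R) (x : R) : lo <= hi ->
  continuous_on (fun r => lo <= r <= hi) f -> continuous (fun z => f (clip lo hi z)) x.
Proof.
intros h fc.
pose proof (clip_range lo hi x h) as hx.
unfold continuous. eapply filterlim_comp; [|apply (fc (clip lo hi x) hx)].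
intros Q hQ. unfold within in hQ.
assert (cc : continuous (clip lo hi) x)
  by (apply continuous_lipschitz; apply clip_lipschitz).
specialize (cc _ hQ).
change (locally x (fun z => lo <= clip lo hi z <= hi -> Q (clip lo hi z))) in cc.
change (locally x (fun z => Q (clip lo hi z))). revert cc. apply filter_imp. intros z hz.
apply hz, clip_range, h.
Qed.

(** The average of [w] over the ball of radius [r], equal to [K * eta] for a density. The value
    [w 0] for [r <= 0] is its limit at the centre. *)
Definition mean (w : R -> R) (r : R) : R :=
  if Rle_dec r 0 then w 0 else 3 * RInt (fun s => w s * s ^ 2) 0 r / r ^ 3.

Lemma mean_pos_eq (w : R -> R) (r : R) : 0 < r ->
  mean w r = 3 * RInt (fun s => w s * s ^ 2) 0 r / r ^ 3.
Proof. intros hr. unfold mean. destruct Rle_dec; [lra|reflexivity]. Qed.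

Lemma mean_derive (w : R -> R) (r : R) : (forall x, continuous w x) -> 0 < r ->
  is_derive (mean w) r (3 * (w r - mean w r) / r).
Proof.
intros wc hr.
assert (qc : forall x, continuous (fun s => w s * s ^ 2) x) by (intros x; cont).
pose proof (RInt_derive _ r qc) as dI.
apply (is_derive_ext_loc (fun r => 3 * RInt (fun s => w s * s ^ 2) 0 r / r ^ 3)).
- apply (locally_interval 0 (r + 1)); [lra|]. intros z hz. now rewrite mean_pos_eq.
- rewrite (mean_pos_eq w r hr).
  set (I := fun x => RInt (fun s => w s * s ^ 2) 0 x).
  change (is_derive I r (w r * r ^ 2)) in dI.
  change (is_derive (fun x => 3 * I x / x ^ 3) r (3 * (w r - 3 * I r / r ^ 3) / r)).
  auto_derive.
  + split; [eexists; eassumption|]. split; [|exact Logic.I]. apply Rgt_not_eq, (pow_lt r 3); lra.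
  + rw_derive dI. field. lra.
Qed.

Lemma mean_cont (w : R -> R) (r : R) : (forall x, continuous w x) -> continuous (mean w) r.
Proof.
intros wc.
destruct (Rtotal_order r 0) as [h | [-> | h]].
- apply (continuous_ext_loc _ (fun _ : R => w 0)); [|apply continuous_const].
  apply (locally_interval (r - 1) 0); [lra|]. intros z hz.
  unfold mean. destruct Rle_dec; [reflexivity|lra].
- apply filterlim_locally. intros eps.
  assert (e2 : 0 < eps / 2) by (pose proof (cond_pos eps); lra).
  destruct (proj1 (filterlim_locally (F := locally 0) _ _) (wc 0) (mkposreal _ e2)) as [d hd].
  exists d. intros z hz. change (Rabs (z - 0) < d) in hz. change (Rabs (mean w z - mean w 0) < eps).
  assert (m0 : mean w 0 = w 0) by (unfold mean; destruct Rle_dec; [reflexivity|lra]).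
  rewrite m0. destruct (Rle_lt_dec z 0) as [zn | zp].
  { unfold mean. destruct Rle_dec; [|lra]. rewrite Rminus_diag, Rabs_R0. apply cond_pos. }
  rewrite Rminus_0_r, Rabs_pos_eq in hz by lra.
  assert (qc : forall x, continuous (fun s => w s * s ^ 2) x) by (intros x; cont).
  set (I := fun x => RInt (fun s => w s * s ^ 2) 0 x).
  (* Used with [e = 1] and [e = -1]. The difference of the two sides has derivative
     [3 s ^ 2 (e (w s - w 0) - eps / 2) <= 0], which avoids dividing by [z ^ 3]. *)
  assert (aux : forall e, Rabs e <= 1 -> e * (3 * I z - w 0 * z ^ 3) <= eps / 2 * z ^ 3).
  { intros e he.
    assert (H : e * (3 * I z - w 0 * z ^ 3) - eps / 2 * z ^ 3
      <= e * (3 * I 0 - w 0 * 0 ^ 3) - eps / 2 * 0 ^ 3).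
    { apply (decreasing_of_derive (fun x => e * (3 * I x - w 0 * x ^ 3) - eps / 2 * x ^ 3));
        [lra|].
      intros s hs. pose proof (RInt_derive _ s qc) as dI. change (is_derive I s (w s * s ^ 2)) in dI.
      exists (3 * s ^ 2 * (e * (w s - w 0) - eps / 2)). split.
      - auto_derive; [repeat split; eexists; eassumption|]. rw_derive dI. field.
      - assert (hw : Rabs (w s - w 0) < eps / 2).
        { apply hd. change (Rabs (s - 0) < d). rewrite Rminus_0_r, Rabs_pos_eq; lra. }
        assert (e * (w s - w 0) <= Rabs e * Rabs (w s - w 0))
          by (rewrite <- Rabs_mult; apply Rle_abs).
        pose proof (Rabs_pos e). pose proof (Rabs_pos (w s - w 0)).
        assert (e * (w s - w 0) - eps / 2 <= 0) by nra.
        pose proof (pow2_ge_0 s). nra. }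
    assert (I0 : I 0 = 0) by exact (RInt_point (V := R_CompleteNormedModule) 0 _).
    rewrite I0 in H. simpl in H. simpl. lra. }
  rewrite mean_pos_eq by assumption. fold (I z).
  assert (z3 : 0 < z ^ 3) by now apply pow_lt.
  pose proof (aux 1 ltac:(rewrite Rabs_R1; lra)).
  pose proof (aux (- (1)) ltac:(rewrite Rabs_Ropp, Rabs_R1; lra)).
  assert (e3 : (3 * I z / z ^ 3 - w 0) * z ^ 3 = 3 * I z - w 0 * z ^ 3) by (field; lra).
  apply Rabs_def1; nra.
- apply (ex_derive_continuous (mean w)). eexists. now apply mean_derive.
Qed.

Lemma mean_gt_0 (w : R -> R) (b : R) : (forall x, continuous w x) ->
  0 < b -> 0 < w 0 -> (forall r, 0 <= w r) -> (forall r, 0 < r < b -> 0 < w r) ->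
  forall r, 0 < mean w r.
Proof.
intros wc hb w0 wn wp r.
destruct (Rle_lt_dec r 0) as [h | h].
{ unfold mean. destruct Rle_dec; lra. }
rewrite mean_pos_eq by assumption.
assert (qc : forall x, continuous (fun s => w s * s ^ 2) x) by (intros x; cont).
assert (Ip : forall r, 0 < r < b -> 0 < RInt (fun s => w s * s ^ 2) 0 r).
{ intros z hz. apply RInt_gt_0; [lra| |intros x _; apply qc].
  intros x hx. apply Rmult_lt_0_compat; [apply wp; lra|apply pow_lt; lra]. }
apply Rdiv_lt_0_compat; [|now apply pow_lt].
apply Rmult_lt_0_compat; [lra|].
destruct (Rlt_le_dec r b) as [h' | h']; [apply Ip; lra|].
(* From [b] on only [0 <= w] is known, but the integral is nondecreasing and already positive at
   [b / 2]. *)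
apply Rlt_le_trans with (RInt (fun s => w s * s ^ 2) 0 (b / 2)); [apply Ip; lra|].
apply Ropp_le_cancel.
apply (decreasing_of_derive (fun r => - RInt (fun s => w s * s ^ 2) 0 r)); [lra|].
intros s hs. exists (- (w s * s ^ 2)). split.
- apply (is_derive_opp (V := R_NormedModule)). apply (RInt_derive _ s qc).
- assert (0 <= w s * s ^ 2) by (apply Rmult_le_pos; [apply wn|apply pow2_ge_0]). lra.
Qed.

Lemma eq_of_eq_interior (f g : R -> R) (b : R) : 0 < b ->
  (forall r, continuous f r) -> (forall r, continuous g r) ->
  (forall r, 0 < r < b -> f r = g r) -> forall r, 0 <= r <= b -> f r = g r.
Proof.
intros hb fc gc h r hr.
destruct (Req_dec r 0) as [-> | n0]; [|destruct (Req_dec r b) as [-> | nb]; [|apply h; lra]].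
- apply Rle_antisym.
  + apply (le_of_le_right f g 0 b hb (fc 0) (gc 0)). intros z hz. right. now apply h.
  + apply (le_of_le_right g f 0 b hb (gc 0) (fc 0)). intros z hz. right. symmetry. now apply h.
- apply Rle_antisym.
  + apply (le_of_le_left f g 0 b hb (fc b) (gc b)). intros z hz. right. now apply h.
  + apply (le_of_le_left g f 0 b hb (gc b) (fc b)). intros z hz. right. symmetry. now apply h.
Qed.

(** Vacuum begins strictly beyond [b]: the surface keeps its interior value, so a jump of the
    density lies outside the closed ball. *)
Definition truncate (b : R) (f : R -> R) (r : R) : R := if Rle_dec r b then f r else 0.

Lemma truncate_in (b : R) (f : R -> R) (r : R) : r <= b -> truncate b f r = f r.
Proof. intros h. unfold truncate. now destruct Rle_dec. Qed.

Lemma truncate_out (b : R) (f : R -> R) (r : R) : b < r -> truncate b f r = 0.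
Proof. intros h. unfold truncate. destruct Rle_dec; [lra|reflexivity]. Qed.

Lemma truncate_derive (b : R) (f : R -> R) (r l : R) : r < b ->
  is_derive f r l -> is_derive (truncate b f) r l.
Proof.
intros h. apply is_derive_ext_loc. apply (locally_interval (r - 1) b); [lra|].
intros z hz. rewrite truncate_in; [reflexivity|lra].
Qed.

Lemma regular_truncate (b : R) (f df : R -> R) :
  (forall r, continuous f r) ->
  (forall r, 0 < r < b -> is_derive f r (df r)) ->
  (forall r, 0 < r < b -> continuous df r) ->
  regular_profile b (truncate b f).
Proof.
intros fc fd dc. split.
- intros r hr. split.
  + exists (df r). apply truncate_derive; [lra|]. now apply fd.
  + apply (continuous_ext_loc _ df); [|now apply dc].
    apply (locally_interval 0 b); [lra|]. intros z hz. symmetry.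
    apply is_derive_unique, truncate_derive; [lra|]. now apply fd.
- intros r hr. rewrite truncate_in by lra.
  apply (filterlim_within_ext _ f).
  + intros z hz. now rewrite truncate_in.
  + eapply filterlim_filter_le_1; [|apply fc]. apply filter_le_within.
Qed.

Section Seth.

Variables (lambda mu K rhoc : R).
Hypotheses (hl : 0 < lambda) (hm : 0 < mu) (hK : 0 < K) (hrho : 0 < rhoc).

(** These constants result from dividing by [lambda + 2 mu]: [kappa] from [lambda u + mu (u + v) =
    (lambda + 2 mu) (v + kappa (u - v))], [grav] from [rho m / r ^ 2], [stiff] from the radial
    pressure; they are the [k], [c], [sigma] of the reduced problem, and [stretch] is its [a]. *)
Definition kappa : R := (lambda + mu) / (lambda + 2 * mu).
Definition grav : R := 4 * PI * K ^ 2 / 3 / (lambda + 2 * mu).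
Definition stiff : R := 2 * lambda / (lambda + 2 * mu).
Definition stretch : R := Rpower (rhoc / K) (1 / 3).

Definition prad_of (u v : R) : R :=
  lambda * u ^ 2 + (lambda + 2 * mu) / 2 * v ^ 2 - seth_p0 lambda mu.
Definition ptan_of (u v : R) : R :=
  (lambda + mu) * u ^ 2 + lambda / 2 * v ^ 2 - seth_p0 lambda mu.

Lemma kappa_range : 0 < kappa < 1.
Proof.
unfold kappa. split; [apply Rdiv_lt_0_compat; lra|].
apply (Rmult_lt_reg_r (lambda + 2 * mu)); [lra|].
unfold Rdiv. rewrite Rmult_assoc, Rinv_l; lra.
Qed.

Lemma grav_pos : 0 < grav.
Proof.
unfold grav. pose proof PI_RGT_0. assert (0 < K ^ 2) by (apply pow_lt; lra).
apply Rdiv_lt_0_compat; [|lra]. apply Rdiv_lt_0_compat; nra.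
Qed.

Lemma stiff_pos : 0 < stiff.
Proof. unfold stiff. apply Rdiv_lt_0_compat; lra. Qed.

Lemma stretch_cube : stretch ^ 3 = rhoc / K.
Proof. apply Rpower_1_3_cube. now apply Rdiv_lt_0_compat. Qed.

Lemma stretch_pos : 0 < stretch.
Proof. apply exp_pos. Qed.

Lemma prad_of_pressure (u v : R) :
  2 / (lambda + 2 * mu) * prad_of u v = stiff * u ^ 2 + v ^ 2 - (stiff + 1).
Proof. unfold prad_of, stiff, seth_p0. field. lra. Qed.

Lemma seth_of_uv (u v : R) : 0 < u ->
  seth_prad lambda mu (u ^ 2 * v) (u ^ 3) = prad_of u v
  /\ seth_ptan lambda mu (u ^ 2 * v) (u ^ 3) = ptan_of u v.
Proof.
intros hu. unfold seth_prad, seth_ptan, prad_of, ptan_of.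
rewrite Rpower_cube_2_3, Rpower_cube_m4_3 by assumption.
split; field; lra.
Qed.

(* [u] and [v] are [R r / r] and [R' r], where [R r] is the radius that the matter
   inside radius [r] occupies at the reference density; in terms of the paper
   [eta = u ^ 3] and [delta = u ^ 2 * v]. *)
Lemma ball_interior_solution (r1 : R) (rho prad ptan : R -> R) :
  seth_ball lambda mu K rhoc r1 rho prad ptan ->
  1 < stretch /\ exists u v, interior_solution kappa grav stiff stretch r1 u v /\
  forall r, 0 <= r <= r1 -> 0 < u r /\ rho r = K * u r ^ 2 * v r
    /\ mass rho r = 4 * PI / 3 * K * (r * u r) ^ 3
    /\ prad r = prad_of (u r) (v r) /\ ptan r = ptan_of (u r) (v r).
Proof.
intros [B [mat rho0]].
pose proof (ball_radius_pos _ _ _ _ B) as hr1.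
pose proof PI_RGT_0 as hpi.
assert (rp : forall r, 0 < r < r1 -> 0 < rho r).
{ intros r hr. destruct (proj2 (ball_domain _ _ _ _ B r) hr) as [d hd].
  apply (hd r). unfold disc. rewrite Rminus_diag, Rabs_R0. apply cond_pos. }
set (w := fun r => rho (clip 0 r1 r)).
assert (wid : forall r, 0 <= r <= r1 -> w r = rho r) by (intros r hr; unfold w; now rewrite clip_id).
assert (wc : forall r, continuous w r).
{ intros r. apply continuous_on_clip; [lra|]. apply (ball_density_regular _ _ _ _ B). }
assert (w0 : w 0 = rhoc) by (rewrite wid by lra; exact rho0).
assert (mp : forall r, 0 < mean w r).
{ apply (mean_gt_0 w r1 wc hr1); [lra| |].
  - intros r. apply (ball_density_nonneg _ _ _ _ B), clip_range. lra.
  - intros r hr. rewrite wid by lra. now apply rp. }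
set (u := fun r => Rpower (mean w r / K) (1 / 3)).
set (v := fun r => w r / (K * u r ^ 2)).
assert (up : forall r, 0 < u r) by (intros r; apply exp_pos).
assert (u3 : forall r, mean w r = K * u r ^ 3).
{ intros r. unfold u. rewrite Rpower_1_3_cube; [field; lra|]. apply Rdiv_lt_0_compat; auto. }
assert (wv : forall r, w r = K * u r ^ 2 * v r).
{ intros r. unfold v. specialize (up r). field. lra. }
assert (uc : forall r, continuous u r).
{ intros r. unfold u.
  apply (continuous_comp (mean w) (fun x => Rpower (x / K) (1 / 3))); [now apply mean_cont|].
  apply (ex_derive_continuous (fun x => Rpower (x / K) (1 / 3))).
  unfold Rpower. auto_derive. apply Rdiv_lt_0_compat; auto. }
assert (vc : forall r, continuous v r).
{ intros r. unfold v. cont. specialize (up r). assert (0 < u r ^ 2) by (apply pow_lt; lra).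
  apply Rgt_not_eq. nra. }
assert (u0 : u 0 = stretch).
{ unfold u, mean. destruct Rle_dec; [|lra]. now rewrite w0. }
assert (v0 : v 0 = stretch).
{ unfold v. rewrite w0, u0. pose proof stretch_pos. pose proof stretch_cube as e.
  assert (rhoc = K * stretch ^ 3) as -> by (rewrite e; field; lra). field. lra. }
assert (massE : forall r, 0 <= r <= r1 -> mass rho r = 4 * PI / 3 * K * (r * u r) ^ 3).
{ intros r hr. unfold mass.
  rewrite (RInt_ext _ (fun s => w s * s ^ 2)).
  2: { intros x hx. rewrite Rmin_left, Rmax_right in hx by lra. rewrite wid by lra. reflexivity. }
  destruct (Req_dec r 0) as [-> | nr].
  - rewrite RInt_point. change (@zero R_CompleteNormedModule) with 0. simpl. ring.
  - pose proof (u3 r) as e. rewrite mean_pos_eq in e by lra.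
    replace (4 * PI / 3 * K * (r * u r) ^ 3) with (4 * PI / 3 * r ^ 3 * (K * u r ^ 3)) by ring.
    rewrite <- e. field. lra. }
assert (relE : forall r, 0 < r < r1 ->
  rel_density K rho r = u r ^ 2 * v r /\ rel_mean_density K rho r = u r ^ 3).
{ intros r hr. unfold rel_density, rel_mean_density.
  rewrite massE, <- wid, wv by lra. split; field; repeat split; lra. }
assert (pE : forall r, 0 < r < r1 ->
  prad r = prad_of (u r) (v r) /\ ptan r = ptan_of (u r) (v r)).
{ intros r hr. destruct (mat r hr) as [e1 e2]. destruct (relE r hr) as [e3 e4].
  rewrite e3, e4 in e1, e2. destruct (seth_of_uv (u r) (v r) (up r)) as [e5 e6].
  rewrite e5 in e1. rewrite e6 in e2. now split. }
assert (prE : forall r, 0 <= r <= r1 -> prad r = prad_of (u r) (v r)).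
{ intros r hr. rewrite <- (clip_id 0 r1 r hr) at 1.
  apply (eq_of_eq_interior (fun r => prad (clip 0 r1 r)) (fun r => prad_of (u r) (v r)) r1);
    try assumption.
  - intros z. apply continuous_on_clip; [lra|]. apply (ball_prad_regular _ _ _ _ B).
  - intros z. unfold prad_of. cont.
  - intros z hz. rewrite clip_id by lra. now apply pE. }
assert (ptE : forall r, 0 <= r <= r1 -> ptan r = ptan_of (u r) (v r)).
{ intros r hr. rewrite <- (clip_id 0 r1 r hr) at 1.
  apply (eq_of_eq_interior (fun r => ptan (clip 0 r1 r)) (fun r => ptan_of (u r) (v r)) r1);
    try assumption.
  - intros z. apply continuous_on_clip; [lra|]. apply (ball_ptan_regular _ _ _ _ B).
  - intros z. unfold ptan_of. cont.
  - intros z hz. rewrite clip_id by lra. now apply pE. }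
assert (vp : forall r, 0 < r < r1 -> 0 < v r).
{ intros r hr. unfold v. rewrite wid by lra. specialize (up r).
  apply Rdiv_lt_0_compat; [now apply rp|]. apply Rmult_lt_0_compat; [lra|apply pow_lt; lra]. }
assert (du : forall r, 0 < r < r1 -> is_derive u r ((v r - u r) / r)).
{ intros r hr. pose proof (mean_derive w r wc ltac:(lra)) as dm.
  unfold u at 1. unfold Rpower. auto_derive.
  - split; [eexists; exact dm|]. split; [|exact I]. apply Rdiv_lt_0_compat; auto.
  - rw_derive dm.
    change (exp (1 / 3 * ln (mean w r * / K))) with (u r).
    rewrite (u3 r), (wv r). specialize (up r). field. lra. }
split.
(* At the centre [u = v = stretch], so the pressure is [(3 lambda + 2 mu) / 2 * (stretch ^ 2 -
   1)]. *)
- pose proof (ball_center_pos _ _ _ _ B) as p0. rewrite prE, u0, v0 in p0 by lra.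
  unfold prad_of, seth_p0 in p0. pose proof stretch_pos.
  apply Rnot_le_lt. intros h. assert (stretch ^ 2 <= 1) by nra. nra.
- exists u, v. split.
  + constructor; try assumption.
    * intros r _. apply up.
    * intros r hr.
      assert (dv : exists l, is_derive v r l).
      { destruct (ball_density_regular _ _ _ _ B) as [C1 _]. destruct (C1 r hr) as [[l dl] _].
        specialize (du r hr). specialize (up r).
        assert (dw : is_derive w r l).
        { apply (is_derive_ext_loc rho); [|exact dl].
          apply (locally_interval 0 r1); [lra|]. intros z hz. rewrite wid; [reflexivity|lra]. }
        assert (ex_derive v r) as [l' dl']; [|now exists l'].
        unfold v. auto_derive. repeat split; try (eexists; eassumption).
        assert (0 < u r ^ 2) by (apply pow_lt; lra). apply Rgt_not_eq. nra. }
      destruct dv as [l dv]. specialize (du r hr).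
      assert (dp : Derive prad r
        = 2 * lambda * u r * ((v r - u r) / r) + (lambda + 2 * mu) * v r * l).
      { apply is_derive_unique.
        apply (is_derive_ext_loc (fun r => prad_of (u r) (v r))).
        - apply (locally_interval 0 r1); [lra|]. intros z hz. symmetry. now apply pE.
        - unfold prad_of. auto_derive; [repeat split; eexists; eassumption|].
          rw_derive du. rw_derive dv. field. lra. }
      pose proof (ball_equilibrium _ _ _ _ B r hr) as eq.
      destruct (pE r hr) as [e1 e2].
      rewrite dp, e1, e2, massE, <- wid, wv in eq by lra.
      unfold prad_of, ptan_of in eq.
      pose proof (vp r hr) as vpr. specialize (up r).
      (* Multiply by [(lambda + 2 mu) v] and add the other terms of the balance: one side is the
         equilibrium expression, the other vanishes identically. *)
      replace (vslope kappa grav r (u r) (v r)) with l; [exact dv|].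
      apply (Rmult_eq_reg_l ((lambda + 2 * mu) * v r)); [|apply Rgt_not_eq; nra].
      apply (Rplus_eq_reg_l (2 * lambda * u r * ((v r - u r) / r) +
       2 / r * (mu * (v r ^ 2 - u r ^ 2)) + K * u r ^ 2 * v r * (4 * PI / 3 * K * (r * u r) ^ 3 / r ^ 2))).
      transitivity 0; [rewrite <- eq; field; lra|].
      unfold vslope, kappa, grav. field. lra.
    * intros r hr. destruct (ball_pressures_pos _ _ _ _ B r hr) as [h _].
      rewrite prE in h by lra. pose proof (prad_of_pressure (u r) (v r)) as e.
      assert (0 < 2 / (lambda + 2 * mu) * prad_of (u r) (v r))
        by (apply Rmult_lt_0_compat; [apply Rdiv_lt_0_compat; lra|exact h]).
      lra.
  + intros r hr. repeat split; auto. rewrite <- wid by assumption. apply wv.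
Qed.

Lemma stretch_gt1 : K < rhoc <-> 1 < stretch.
Proof.
pose proof stretch_cube as e. pose proof stretch_pos as sp.
assert (e' : rhoc = K * stretch ^ 3) by (rewrite e; field; lra).
split; intros h.
- apply Rnot_le_lt. intros h'.
  assert (stretch ^ 3 <= 1 ^ 3) by (apply pow_incr; lra). nra.
- assert (1 < stretch ^ 3) by (apply Rlt_pow_R1; [lra|auto with arith]). nra.
Qed.

(** The cube root is [r1 * u r1], so the claims concern [u r1] alone. The surface condition is [2
    lambda u ^ 2 + (lambda + 2 mu) v ^ 2 = 3 lambda + 2 mu]: dropping [v ^ 2 > 0] bounds [u] from
    above, and [v < u] gives [u > 1]. Strictness of [v < u] at [r1] is supplied by [sol_gap]. *)
Lemma ball_estimates (r1 : R) (rho prad ptan : R -> R) :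
  seth_ball lambda mu K rhoc r1 rho prad ptan ->
  0 < rho r1
  /\ 0 < mass rho r1
  /\ sqrt (2 * lambda / (3 * lambda + 2 * mu))
     * Rpower (3 * mass rho r1 / (4 * PI * K)) (1 / 3) < r1
  /\ r1 < Rpower (3 * mass rho r1 / (4 * PI * K)) (1 / 3)
  /\ mass rho r1 < 4 * PI / 3 * rhoc * r1 ^ 3.
Proof.
intros HB. destruct (ball_interior_solution _ _ _ _ HB) as [ha [u [v [S E]]]].
destruct HB as [B _]. pose proof (ball_radius_pos _ _ _ _ B) as hr1.
destruct (E r1 ltac:(lra)) as [up [erho [emass [ep _]]]].
rewrite (ball_surface _ _ _ _ B) in ep.
pose proof (sol_u_cont _ _ _ _ _ _ _ S) as uc. pose proof (sol_v_cont _ _ _ _ _ _ _ S) as vc.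
pose proof kappa_range as hk. pose proof grav_pos as hc. pose proof stiff_pos as hs.
pose proof PI_RGT_0 as hpi.
assert (vp : 0 < v r1).
{ apply Rlt_le_trans with (v_min kappa grav stretch); [now apply v_min_pos|].
  apply (le_of_le_left (fun _ => v_min kappa grav stretch) v 0 r1); [lra|cont|cont|].
  intros r hr. left. now apply (sol_v_gt _ _ _ _ hk hc hs ha _ _ _ S). }
destruct (sol_gap _ _ _ _ hk hc hs ha _ _ _ S) as [eps [heps gap]].
assert (vu : v r1 < u r1).
{ assert (v r1 <= u r1 - eps * r1 ^ 2).
  { apply (le_of_le_left v (fun r => u r - eps * r ^ 2) 0 r1); [lra|cont|cont|].
    intros r hr. left. now apply gap. }
  assert (0 < eps * r1 ^ 2) by (apply Rmult_lt_0_compat; [lra|apply pow_lt; lra]). lra. }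
assert (ua : u r1 < stretch).
(* An intermediate point keeps [u < stretch] strict: [u] does not increase from [r1 / 2] to [r1]. *)
{ apply Rle_lt_trans with (u (r1 / 2)).
  - apply (le_of_le_left u (fun _ => u (r1 / 2)) (r1 / 2) r1); [lra|cont|cont|].
    intros r hr. apply decreasing_of_derive; [lra|]. intros z hz.
    assert (hz' : 0 < z < r1) by lra.
    exists ((v z - u z) / z). split; [now apply (sol_du _ _ _ _ _ _ _ S)|].
    assert (v z < u z) by exact (sol_v_lt_u _ _ _ _ hk hc _ _ _ S z hz').
    apply (Rmult_le_reg_r z); [lra|]. unfold Rdiv. rewrite Rmult_assoc, Rinv_l; lra.
  - apply (sol_u_lt_a _ _ _ _ hk hc _ _ _ S). lra. }
unfold prad_of, seth_p0 in ep.
assert (u1 : 1 < u r1).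
{ apply Rnot_le_lt. intros h. assert (u r1 ^ 2 <= 1) by nra.
  assert (v r1 ^ 2 < u r1 ^ 2) by nra. nra. }
assert (cube : 3 * mass rho r1 / (4 * PI * K) = (r1 * u r1) ^ 3)
  by (rewrite emass; field; lra).
rewrite cube, Rpower_cube_1_3 by nra.
assert (u3 : 0 < (r1 * u r1) ^ 3) by (apply pow_lt; nra).
assert (r3 : 0 < r1 ^ 3) by (apply pow_lt; lra).
assert (p4 : 0 < 4 * PI / 3 * K)
  by (apply Rmult_lt_0_compat; [apply Rdiv_lt_0_compat|]; lra).
split; [|split; [|split; [|split]]].
- rewrite erho. repeat apply Rmult_lt_0_compat; lra.
- rewrite emass. now apply Rmult_lt_0_compat.
- set (q := 2 * lambda / (3 * lambda + 2 * mu)).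
  assert (hq : 0 < q) by (apply Rdiv_lt_0_compat; lra).
  pose proof (sqrt_lt_R0 q hq) as sp. pose proof (sqrt_sqrt q ltac:(lra)) as sq.
  assert (qu : q * u r1 ^ 2 < 1).
  { assert (q * (3 * lambda + 2 * mu) = 2 * lambda) by (unfold q; field; lra).
    assert (0 < v r1 ^ 2) by (apply pow_lt; lra).
    assert (2 * lambda * u r1 ^ 2 < 3 * lambda + 2 * mu) by nra. nra. }
  assert (sqrt q * u r1 < 1); [|nra].
  apply Rnot_le_lt. intros h.
  assert (1 * 1 <= (sqrt q * u r1) * (sqrt q * u r1)) by (apply Rmult_le_compat; lra). nra.
- nra.
- assert (rhoc = K * stretch ^ 3) as -> by (rewrite stretch_cube; field; lra).
  rewrite emass.
  assert (u r1 ^ 3 < stretch ^ 3).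
  { replace (stretch ^ 3) with (stretch * stretch * stretch) by ring.
    replace (u r1 ^ 3) with (u r1 * u r1 * u r1) by ring.
    repeat apply Rmult_gt_0_lt_compat; nra. }
  replace (4 * PI / 3 * K * (r1 * u r1) ^ 3) with (4 * PI / 3 * K * r1 ^ 3 * u r1 ^ 3) by ring.
  replace (4 * PI / 3 * (K * stretch ^ 3) * r1 ^ 3) with (4 * PI / 3 * K * r1 ^ 3 * stretch ^ 3) by ring.
  apply Rmult_lt_compat_l; [|assumption]. now apply Rmult_lt_0_compat.
Qed.

(** If [r1 < r2], both solutions agree up to [r1], and the second ball would have zero radial
    pressure at an interior point. *)
Lemma ball_radius_le (r1 r2 : R) (rho1 prad1 ptan1 rho2 prad2 ptan2 : R -> R) :
  seth_ball lambda mu K rhoc r1 rho1 prad1 ptan1 ->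
  seth_ball lambda mu K rhoc r2 rho2 prad2 ptan2 -> r2 <= r1.
Proof.
intros HB1 HB2.
destruct (ball_interior_solution _ _ _ _ HB1) as [ha [u1 [v1 [S1 E1]]]].
destruct (ball_interior_solution _ _ _ _ HB2) as [_ [u2 [v2 [S2 E2]]]].
destruct HB1 as [B1 _]. destruct HB2 as [B2 _].
pose proof (ball_radius_pos _ _ _ _ B1) as hr1.
apply Rnot_lt_le. intros h.
pose proof (sol_unique _ _ _ _ kappa_range grav_pos stiff_pos ha _ _ _ _ _ _ S1 S2) as U.
assert (eu : u1 r1 = u2 r1).
{ apply (eq_of_eq_interior u1 u2 r1 hr1 (sol_u_cont _ _ _ _ _ _ _ S1) (sol_u_cont _ _ _ _ _ _ _ S2)); [|lra].
  intros r hr. apply U; lra. }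
assert (ev : v1 r1 = v2 r1).
{ apply (eq_of_eq_interior v1 v2 r1 hr1 (sol_v_cont _ _ _ _ _ _ _ S1) (sol_v_cont _ _ _ _ _ _ _ S2)); [|lra].
  intros r hr. apply U; lra. }
destruct (E1 r1 ltac:(lra)) as [_ [_ [_ [p1 _]]]].
destruct (E2 r1 ltac:(lra)) as [_ [_ [_ [p2 _]]]].
destruct (ball_pressures_pos _ _ _ _ B2 r1 ltac:(lra)) as [pp _].
rewrite (ball_surface _ _ _ _ B1) in p1. rewrite <- eu, <- ev in p2. lra.
Qed.

Lemma ball_unique (r1 r2 : R) (rho1 prad1 ptan1 rho2 prad2 ptan2 : R -> R) :
  seth_ball lambda mu K rhoc r1 rho1 prad1 ptan1 ->
  seth_ball lambda mu K rhoc r2 rho2 prad2 ptan2 ->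
  forall r, 0 <= r -> rho2 r = rho1 r /\ prad2 r = prad1 r /\ ptan2 r = ptan1 r.
Proof.
intros HB1 HB2.
assert (r2 = r1) as -> by (apply Rle_antisym; eapply ball_radius_le; eassumption).
destruct (ball_interior_solution _ _ _ _ HB1) as [ha [u1 [v1 [S1 E1]]]].
destruct (ball_interior_solution _ _ _ _ HB2) as [_ [u2 [v2 [S2 E2]]]].
destruct HB1 as [B1 _]. destruct HB2 as [B2 _].
pose proof (ball_radius_pos _ _ _ _ B1) as hr1.
pose proof (sol_unique _ _ _ _ kappa_range grav_pos stiff_pos ha _ _ _ _ _ _ S1 S2) as U.
intros r hr. destruct (Rle_lt_dec r r1) as [h | h].
- assert (eu : u1 r = u2 r).
  { apply (eq_of_eq_interior u1 u2 r1 hr1 (sol_u_cont _ _ _ _ _ _ _ S1) (sol_u_cont _ _ _ _ _ _ _ S2)); [|lra].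
    intros z hz. apply U; lra. }
  assert (ev : v1 r = v2 r).
  { apply (eq_of_eq_interior v1 v2 r1 hr1 (sol_v_cont _ _ _ _ _ _ _ S1) (sol_v_cont _ _ _ _ _ _ _ S2)); [|lra].
    intros z hz. apply U; lra. }
  destruct (E1 r ltac:(lra)) as [_ [-> [_ [-> ->]]]].
  destruct (E2 r ltac:(lra)) as [_ [-> [_ [-> ->]]]].
  rewrite eu, ev. auto.
- destruct (ball_vacuum _ _ _ _ B1 r h) as [-> [-> ->]].
  destruct (ball_vacuum _ _ _ _ B2 r h) as [-> [-> ->]]. auto.
Qed.

Lemma ball_exists : 1 < stretch -> exists r1 rho prad ptan,
  seth_ball lambda mu K rhoc r1 rho prad ptan.
Proof.
intros ha. pose proof kappa_range as hk. pose proof grav_pos as hc.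
pose proof stiff_pos as hs. pose proof PI_RGT_0 as hpi.
destruct (sol_exists _ _ _ _ hk hc hs ha) as
  [b [u [v [y [hb [S [surf [ub [vb [yc [du vE]]]]]]]]]]].
pose proof (sol_u_cont _ _ _ _ _ _ _ S) as uc. pose proof (sol_v_cont _ _ _ _ _ _ _ S) as vc.
pose proof (sol_u0 _ _ _ _ _ _ _ S) as u0. pose proof (sol_v0 _ _ _ _ _ _ _ S) as v0.
assert (uvp : forall r, 0 <= r <= b -> 0 < u r /\ 0 < v r).
{ intros r hr. destruct (Req_dec r 0) as [-> | n0]; [lra|].
  destruct (Req_dec r b) as [-> | nb]; [lra|]. split.
  - apply (sol_u_pos _ _ _ _ _ _ _ S). lra.
  - apply (sol_v_pos _ _ _ _ _ _ _ S). lra. }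
set (dv := fun r => vslope kappa grav r (u r) (v r)).
pose proof (sol_dv _ _ _ _ _ _ _ S) as Dv.
assert (dvc : forall r, 0 < r < b -> continuous dv r).
{ intros r hr. unfold dv, vslope. destruct (uvp r ltac:(lra)). cont. apply Rgt_not_eq. nra. }
set (rho := truncate b (fun r => K * u r ^ 2 * v r)).
set (prad := truncate b (fun r => prad_of (u r) (v r))).
set (ptan := truncate b (fun r => ptan_of (u r) (v r))).
assert (dprad : forall r, 0 < r < b -> is_derive (fun r => prad_of (u r) (v r)) r
  (2 * lambda * u r * y r + (lambda + 2 * mu) * v r * dv r)).
{ intros r hr. specialize (Dv r hr). specialize (du r). unfold prad_of.
  auto_derive; [repeat split; eexists; eassumption|]. rw_derive du. rw_derive Dv.
  unfold dv. field. }
assert (massE : forall r, 0 <= r <= b -> mass rho r = 4 * PI / 3 * K * (r * u r) ^ 3).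
{ intros r hr. unfold mass.
  rewrite (RInt_ext _ (fun s => K * u s ^ 2 * v s * s ^ 2)).
  2: { intros x hx. rewrite Rmin_left, Rmax_right in hx by lra.
       unfold rho. rewrite truncate_in by lra. reflexivity. }
  (* [K / 3 * (s u) ^ 3] is an antiderivative of the integrand because [(s u)' = u + s y = v]. *)
  assert (h : is_RInt (fun s => K * u s ^ 2 * v s * s ^ 2) 0 r
    (minus (K / 3 * (r * u r) ^ 3) (K / 3 * (0 * u 0) ^ 3))).
  { apply (is_RInt_derive (fun s => K / 3 * (s * u s) ^ 3)).
    - intros x _. specialize (du x). rewrite vE. auto_derive; [eexists; eassumption|].
      rw_derive du. field.
    - intros x _. cont. }
  rewrite (is_RInt_unique _ _ _ _ h). unfold minus, plus, opp; simpl. field. }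
assert (pp : forall r, 0 < r < b -> 0 < prad_of (u r) (v r)).
{ intros r hr. pose proof (sol_pressure _ _ _ _ _ _ _ S r hr).
  pose proof (prad_of_pressure (u r) (v r)) as e.
  apply (Rmult_lt_reg_l (2 / (lambda + 2 * mu))); [apply Rdiv_lt_0_compat; lra|]. lra. }
assert (lv : forall r, 0 < r < b -> v r < u r)
  by exact (sol_v_lt_u _ _ _ _ hk hc _ _ _ S).
assert (rc : rhoc = K * stretch ^ 3) by (rewrite stretch_cube; field; lra).
exists b, rho, prad, ptan. split; [|split].
- constructor.
  + exact hb.
  + intros r hr. unfold rho. destruct (Rle_lt_dec r b) as [h | h].
    * rewrite truncate_in by lra. destruct (uvp r ltac:(lra)).
      left. repeat apply Rmult_lt_0_compat; lra.
    * rewrite truncate_out by lra. lra.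
  + intros r. split.
    * intros [d hd]. pose proof (cond_pos d) as dp.
      assert (hr : 0 < r /\ 0 < rho r).
      { apply hd. unfold disc. rewrite Rminus_diag, Rabs_R0. lra. }
      split; [lra|]. apply Rnot_le_lt. intros h.
      (* This also excludes [r = b], where the density is positive but vacuum lies arbitrarily
         near. *)
      destruct (hd (r + d / 2)) as [_ h'].
      { unfold disc. replace (r + d / 2 - r) with (d / 2) by ring.
        rewrite Rabs_pos_eq; lra. }
      unfold rho in h'. rewrite truncate_out in h'; lra.
    * intros hr.
      destruct (locally_interval 0 b r (fun s => 0 < s /\ 0 < rho s)) as [d hd]; [lra| |].
      { intros z hz. split; [lra|]. unfold rho. rewrite truncate_in by lra.
        destruct (uvp z ltac:(lra)). repeat apply Rmult_lt_0_compat; lra. }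
      exists d. intros z hz. apply hd. exact hz.
  + apply (regular_truncate b _ (fun r => K * (2 * u r * y r * v r + u r ^ 2 * dv r)));
      [intros r; cont| |].
    * intros r hr. specialize (Dv r hr). specialize (du r).
      auto_derive; [repeat split; eexists; eassumption|]. rw_derive du. rw_derive Dv.
      unfold dv. ring.
    * intros r hr. specialize (dvc r hr). cont.
  + apply (regular_truncate b _
      (fun r => 2 * lambda * u r * y r + (lambda + 2 * mu) * v r * dv r));
      [intros r; unfold prad_of; cont|exact dprad|].
    intros r hr. specialize (dvc r hr). cont.
  + apply (regular_truncate b _
      (fun r => 2 * (lambda + mu) * u r * y r + lambda * v r * dv r));
      [intros r; unfold ptan_of; cont| |].
    * intros r hr. specialize (Dv r hr). specialize (du r). unfold ptan_of.
      auto_derive; [repeat split; eexists; eassumption|]. rw_derive du. rw_derive Dv.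
      unfold dv. field.
    * intros r hr. specialize (dvc r hr). cont.
  + intros r hr.
    assert (Derive prad r = 2 * lambda * u r * y r + (lambda + 2 * mu) * v r * dv r) as ->.
    { apply is_derive_unique. apply truncate_derive; [lra|]. now apply dprad. }
    rewrite massE by lra. unfold prad, ptan, rho. rewrite !truncate_in by lra.
    destruct (uvp r ltac:(lra)).
    replace (y r) with ((v r - u r) / r) by (rewrite vE; field; lra).
    unfold dv, prad_of, ptan_of, vslope, kappa, grav. field. lra.
  + intros r hr. unfold prad, ptan. rewrite !truncate_in by lra.
    specialize (pp r hr). specialize (lv r hr). destruct (uvp r ltac:(lra)).
    split; [exact pp|]. unfold prad_of, ptan_of in *.
    (* The tangential pressure exceeds the radial one by [mu (u ^ 2 - v ^ 2)]. *)
    assert (v r ^ 2 < u r ^ 2) by nra. nra.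
  + unfold prad. rewrite truncate_in by lra.
    pose proof (prad_of_pressure (u b) (v b)) as e.
    apply (Rmult_eq_reg_l (2 / (lambda + 2 * mu))); [lra|].
    apply Rgt_not_eq, Rdiv_lt_0_compat; lra.
  + unfold prad. rewrite truncate_in, u0, v0 by lra. unfold prad_of, seth_p0.
    assert (1 < stretch ^ 2) by nra. nra.
  + unfold prad, ptan. rewrite !truncate_in, u0, v0 by lra. unfold prad_of, ptan_of. field.
  + intros r hr. unfold rho, prad, ptan. rewrite !truncate_out by lra. auto.
- intros r hr. destruct (uvp r ltac:(lra)) as [up vp].
  destruct (seth_of_uv (u r) (v r) up) as [e1 e2].
  assert (rel_density K rho r = u r ^ 2 * v r) as ->.
  { unfold rel_density, rho. rewrite truncate_in by lra. field. lra. }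
  assert (rel_mean_density K rho r = u r ^ 3) as ->.
  { unfold rel_mean_density. rewrite massE by lra. field. lra. }
  rewrite e1, e2. unfold prad, ptan. rewrite !truncate_in by lra. auto.
- unfold rho. rewrite truncate_in, u0, v0, rc by lra. ring.
Qed.

End Seth.

Theorem theorem2 :
  forall (lambda mu K rhoc : R),
    0 < lambda -> 0 < mu -> 0 < K -> 0 < rhoc ->
    ((exists rho prad ptan : R -> R,
        (exists r1 : R, seth_ball lambda mu K rhoc r1 rho prad ptan)
        /\ (forall rho' prad' ptan' : R -> R,
              (exists r1' : R,
                  seth_ball lambda mu K rhoc r1' rho' prad' ptan') ->
              forall r : R, 0 <= r ->
                rho' r = rho r /\ prad' r = prad r /\ ptan' r = ptan r))
     <-> K < rhoc)
    /\
    (forall (r1 : R) (rho prad ptan : R -> R),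
        seth_ball lambda mu K rhoc r1 rho prad ptan ->
        0 < rho r1
        /\ 0 < mass rho r1
        /\ sqrt (2 * lambda / (3 * lambda + 2 * mu))
           * Rpower (3 * mass rho r1 / (4 * PI * K)) (1 / 3) < r1
        /\ r1 < Rpower (3 * mass rho r1 / (4 * PI * K)) (1 / 3)
        /\ mass rho r1 < 4 * PI / 3 * rhoc * r1 ^ 3).
Proof.
intros lambda mu K rhoc hl hm hK hrho. split; [split|].
- intros [rho [prad [ptan [[r1 B] _]]]].
  apply stretch_gt1; try assumption.
  apply (ball_interior_solution lambda mu K rhoc hl hm hK hrho r1 rho prad ptan B).
- intros h. apply stretch_gt1 in h; try assumption.
  destruct (ball_exists lambda mu K rhoc hl hm hK hrho h) as [r1 [rho [prad [ptan B]]]].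
  exists rho, prad, ptan. split; [now exists r1|].
  intros rho' prad' ptan' [r1' B'].
  exact (ball_unique lambda mu K rhoc hl hm hK hrho _ _ _ _ _ _ _ _ B B').
- intros r1 rho prad ptan B.
  exact (ball_estimates lambda mu K rhoc hl hm hK hrho r1 rho prad ptan B).
Qed.
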